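(* Let $A$ be a separable $C^*$-algebra and let $(p_n)_{n\in\mathbb N}$ be an increasing sequence of open projections in $A^{**}$. Then $$A_p=\overline{\bigcup_{k\in\mathbb N}A_{p_k}}\quad\text{(norm closure)},$$ where $p$ is the limit of $(p_n)$ in the strong operator topology.
   Context: $A^{**}$ is the bidual of $A$, identified with the strong operator closure of $A$ in its universal representation. A projection $p\in A^{**}$ is open if it is the strong limit of an increasing net of positive elements of $A$. For a projection $p\in A^{**}$, $A_p:=pA^{**}p\cap A$. Increasing means $p_n\le p_{n+1}$ as positive elements. It is known (Akemann) that the strong limit of an increasing sequence of open projections is an open projection. *)

(* Defs.v *)
From HB Require Import structures.
From mathcomp Require Import all_boot all_order all_algebra complex.
From mathcomp Require Import all_classical all_reals all_analysis.

Set Implicit Arguments.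
Unset Strict Implicit.
Unset Printing Implicit Defensive.

Import Order.TTheory GRing.Theory Num.Theory.
Import numFieldNormedType.Exports.

Local Open Scope classical_set_scope.
Local Open Scope ring_scope.

(* The algebra is not assumed to be unital, so the product is not taken from
   the ring hierarchy of MathComp, all of whose rings have a unit. *)
HB.mixin Record isCStarAlgebra (R : realType) A
    of CompleteNormedModule R[i] A := {
  cmul : A -> A -> A ;
  cstar : A -> A ;
  cmulA : associative cmul ;
  cmul_linearl : forall b : A, linear (cmul^~ b) ;
  cmul_linearr : forall a : A, linear (cmul a) ;
  cstarK : involutive cstar ;
  cstarM : forall a b : A, cstar (cmul a b) = cmul (cstar b) (cstar a) ;
  cstar_antilinear : forall (c : R[i]) (a b : A),
    cstar (c *: a + b) = Num.conj c *: cstar a + cstar b ;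
  cnorm_mul : forall a b : A, `|cmul a b| <= `|a| * `|b| ;
  cnorm_star : forall a : A, `|cmul (cstar a) a| = `|a| ^+ 2
}.

#[short(type="cstarAlgType")]
HB.structure Definition CStarAlgebra (R : realType) :=
  {A of CompleteNormedModule R[i] A & isCStarAlgebra R A}.

(* A form of type {dot H for conj} is linear in its first argument. *)
HB.mixin Record isHilbert (R : realType) H of CompleteNormedModule R[i] H := {
  inner : {dot H for Num.conj} ;
  inner_norm : forall x : H, inner x x = `|x| ^+ 2
}.

#[short(type="hilbertType")]
HB.structure Definition Hilbert (R : realType) :=
  {H of CompleteNormedModule R[i] H & isHilbert R H}.

Section CStar.
Context {R : realType} {A : cstarAlgType R}.
Implicit Types (a b : A) (phi : A -> R[i]).

Definition separable := exists2 D : set A, countable D & dense D.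

Definition cpos a := exists b, a = cmul (cstar b) b.

Definition cle a b := cpos (b - a).

(* The supremum of an unbounded set is 0 by convention, hence
   functional_norm phi = 1 entails that phi is bounded. *)
Definition functional_norm phi : R :=
  sup [set complex.Re `|phi a| | a in [set a | `|a| <= 1]].

Definition state phi :=
  [/\ scalar phi, forall a, cpos a -> 0 <= phi a & functional_norm phi = 1].

End CStar.
Arguments separable {R} A.

Section Operators.
Context {R : realType} {H : hilbertType R}.
Implicit Types S T : H -> H.

Definition bounded_operator T := linear T /\ continuous T.

Definition adjoint S T := forall x y : H, inner (S x) y = inner x (T y).

(* The strong operator topology is the topology of pointwise convergence. *)
Definition sot_closure (M : set (H -> H)) : set (H -> H) :=
  [set T | bounded_operator T /\ closure (M : set {ptws H -> H}) T].

Definition sot_cvg (F : set_system (H -> H)) T :=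
  bounded_operator T /\ {ptws, F --> T}.

End Operators.

Definition directed (I : Type) (le : I -> I -> Prop) :=
  [/\ inhabited I, forall i, le i i,
      forall i j k, le i j -> le j k -> le i k &
      forall i j, exists k, le i k /\ le j k].

Definition net_filter (I : Type) (le : I -> I -> Prop) : set_system I :=
  filter_from setT (fun i => [set j | le i j]).

Section Bidual.
Context {R : realType} {A : cstarAlgType R} {H : hilbertType R}.
Implicit Types (pi : A -> H -> H) (p q T : H -> H).

Definition representation pi :=
  [/\ forall a, bounded_operator (pi a),
      forall x : H, linear (pi^~ x),
      forall a b, pi (cmul a b) = pi a \o pi b &
      forall a, adjoint (pi a) (pi (cstar a))].

Definition cyclic_subspace pi (xi : H) : set H :=
  closure [set pi a xi | a in setT].

(* The universal representation is the Hilbert sum, over all the states phi of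
   A, of the GNS representations (H_phi, pi_phi, xi_phi).  It is defined up to
   unitary equivalence, and pi is a copy of it when H is the Hilbert sum of
   pairwise orthogonal closed subspaces H_phi on which pi acts as pi_phi, i.e.
   with a cyclic vector xi_phi such that phi(a) = <pi(a) xi_phi, xi_phi>.  The
   values of xi at functionals that are not states play no role. *)
Definition universal_representation pi :=
  representation pi /\
  exists xi : (A -> R[i]) -> H,
    [/\ forall phi, state phi ->
          cyclic_subspace pi (xi phi) (xi phi) /\
          forall a, phi a = inner (pi a (xi phi)) (xi phi),
        forall phi psi, state phi -> state psi -> phi <> psi ->
          forall x y, cyclic_subspace pi (xi phi) x ->
            cyclic_subspace pi (xi psi) y -> inner x y = 0 &
        dense [set v | exists s : seq H, v = \sum_(x <- s) x /\
          forall x, x \in s ->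
            exists2 phi, state phi & cyclic_subspace pi (xi phi) x]].

(* In all that follows pi is meant to be universal. *)
Definition bidual pi : set (H -> H) := sot_closure (range pi).

Definition bidual_pos pi T := exists S S' : H -> H,
  [/\ bidual pi S, bidual pi S', adjoint S S' & T = S' \o S].

Definition bidual_le pi p q := bidual_pos pi (q \- p).

Definition projection pi p := [/\ bidual pi p, p \o p = p & adjoint p p].

Definition open_projection pi p :=
  projection pi p /\
  exists (I : Type) (le : I -> I -> Prop) (x : I -> A),
    [/\ directed le,
        forall i, cpos (x i),
        forall i j, le i j -> cle (x i) (x j) &
        sot_cvg ((fun i => pi (x i)) @ net_filter le) p].

(* p A^** p \cap A, as a subset of A. *)
Definition corner pi p : set A :=
  [set a | exists2 T, bidual pi T & pi a = p \o T \o p].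

End Bidual.

(* Main.v *)
(* The inclusion of the closure in [A_p] only needs [p_k <= p] and the fact that
   representations are contractive.  Conversely let [a] be in [A_p] and let [X]
   be the convex set of the positive [x] in [A] with [x <= p_k] for some [k].
   For a state [psi], which is a vector state of the universal representation,
   [psi (aa^* - axa^* + a^*a - a^*xa)] has infimum [0] over [x] in [X]: [p_k]
   converges strongly to [p], each [p_k] is a strong limit of elements of [X],
   and [p] fixes [pi(a) v] and [pi(b) v] for [b = a^*].  By convexity of [X] and the
   Hahn-Banach theorem, applied to the order of [A], the infimum over [X] of the
   norms of these elements is then [0] too.  They dominate [|(1 - x)a|^2] and
   [|a(1 - x)|^2], so [xax], which lies in [A_{p_k}], approximates [a].

   This uses that the universal representation is isometric, hence that [A] has
   enough states, hence that [b^*b] is positive in the sense that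
   [|t - b^*b| <= t] for some [t > 0]. *)
Require Import Defs.
From HB Require Import structures.
From mathcomp Require Import all_boot all_order all_algebra complex.
From mathcomp Require Import all_classical all_reals all_analysis.
From mathcomp Require Import ring lra.

Set Implicit Arguments.
Unset Strict Implicit.
Unset Printing Implicit Defensive.

Import Order.TTheory GRing.Theory Num.Theory.
Import numFieldNormedType.Exports.
Local Open Scope classical_set_scope.
Local Open Scope ring_scope.

Local Notation "x %:C" := (real_complex _ x).

(** The obstacle is uniformity: strong convergence yields, for each state, an element of [X] suited
    to that state, and a single one has to serve all of them. Hence a separation argument: if all
    the norms were at least [d], one state would be bounded below on all the elements by a positive
    constant. Adding the left and the right expression lets one [x] serve both sides of [a]. As
    there may be no unit, a state is normalised by its norm and the constant of the separation is
    not controlled; each contradiction uses only that it is positive. For the same reason positivity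
    is expressed by operators on [A], and the functional calculus is reduced to an iterative square
    root that commutes with every bounded operator commuting with the given one. Hahn-Banach is
    applied to a cone of pairs [(t, g)], which gathers the positivity of the functional and its
    lower bounds; it serves twice, for the isometry and for the density. *)

Section RealNorm.
Context {R : realType} {V : completeNormedModType R[i]}.
Implicit Types (x y : V) (r : R).

(* The norms of the library take their values in [R[i]]; their real parts allow
   the use of the total order of [R]. *)
Definition nrm x : R := complex.Re `|x|.

Lemma nrmE x : `|x| = (nrm x)%:C.
Proof. by rewrite /nrm RRe_real // normr_real. Qed.

Lemma nrm_ge0 x : 0 <= nrm x.
Proof. by rewrite -lecR -nrmE normr_ge0. Qed.

Lemma nrm0 : nrm (0 : V) = 0.
Proof. by rewrite /nrm normr0. Qed.

Lemma nrm0_eq0 x : nrm x = 0 -> x = 0.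
Proof. by move=> h; apply/eqP; rewrite -normr_eq0 nrmE h. Qed.

Lemma nrmD x y : nrm (x + y) <= nrm x + nrm y.
Proof. by rewrite -lecR rmorphD /= -!nrmE ler_normD. Qed.

Lemma nrmN x : nrm (- x) = nrm x.
Proof. by rewrite /nrm normrN. Qed.

Lemma nrmB x y : nrm (x - y) <= nrm x + nrm y.
Proof. by rewrite -(nrmN y) nrmD. Qed.

Lemma nrm_sub x y : nrm (x - y) = nrm (y - x).
Proof. by rewrite -nrmN opprB. Qed.

Lemma nrmZ (c : R[i]) x : nrm (c *: x) = complex.Re `|c| * nrm x.
Proof.
by apply: complexI; rewrite -nrmE normrZ nrmE rmorphM; congr (_ * _).
Qed.

Lemma nrmZr r x : nrm (r%:C *: x) = `|r| * nrm x.
Proof. by rewrite nrmZ normc_def /= expr0n /= addr0 sqrtr_sqr. Qed.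

Lemma nrmZi x : nrm ('i *: x) = nrm x.
Proof. by rewrite nrmZ normCi mul1r. Qed.

Lemma nrm_le_eps x M : (forall e, 0 < e -> nrm x <= M + e) -> nrm x <= M.
Proof. by move=> h; apply/ler_addgt0Pr. Qed.

Lemma cvg_nrmP (T : Type) (F : set_system T) (FF : Filter F) (f : T -> V) l :
  f @ F --> l <-> forall e : R, 0 < e -> \forall t \near F, nrm (f t - l) <= e.
Proof.
split.
- move=> /cvgrPdist_le h e e0.
  have := h e%:C; rewrite ltcR => /(_ e0).
  by apply: filterS => t; rewrite distrC nrmE lecR.
- move=> h; apply/cvgrPdist_le => e e0.
  have e_real : e = (complex.Re e)%:C by rewrite RRe_real // ger0_real // ltW.
  have : 0 < complex.Re e by rewrite -ltcR -e_real.
  by move=> /h; apply: filterS => t; rewrite distrC nrmE e_real lecR.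
Qed.

Lemma nrm_cauchy_cvg (u : nat -> V) (s : nat -> R) :
  (forall n m, (n <= m)%N -> nrm (u m - u n) <= s m - s n) ->
  has_ubound (range s) -> cvgn u.
Proof.
move=> us sb; apply/cauchy_cvgP/cauchy_exP => e e0.
have e_real : e = (complex.Re e)%:C by rewrite RRe_real // ger0_real // ltW.
have e'0 : 0 < complex.Re e by rewrite -ltcR -e_real.
have [_ [N _ <-] hN] : exists2 x, range s x & sup (range s) - complex.Re e < x.
  by apply: sup_adherent => //; split => //; exists (s 0%N), 0%N.
exists (u N); exists N => // n /= Nn.
rewrite -ball_normE /= e_real -normrN opprB nrmE ltcR.
apply: le_lt_trans (us _ _ Nn) _.
have : s n <= sup (range s) by apply: ub_le_sup => //; exists n.
by lra.
Qed.

End RealNorm.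

(** * A Hahn-Banach theorem relative to a convex cone *)

Section HahnBanach.
Context {R : realType} {V : lmodType R[i]}.
Implicit Types (p q : V -> R) (G : set (R * V)).

Definition sublinear q :=
  (forall x y, q (x + y) <= q x + q y) /\
  (forall (r : R) x, 0 <= r -> q (r%:C *: x) = r * q x).

Definition cone G :=
  [/\ G (0, 0),
      forall g h, G g -> G h -> G (g.1 + h.1, g.2 + h.2) &
      forall (r : R) g, 0 <= r -> G g -> G (r * g.1, r%:C *: g.2)].

Lemma sublinear0 q : sublinear q -> q 0 = 0.
Proof. by case=> _ /(_ 0 0 (lexx _)); rewrite scaler0 mul0r. Qed.

Lemma sublinear_ge q x y : sublinear q -> q y - q (- x) <= q (x + y).
Proof. by case=> /(_ (- x) (x + y)); rewrite addKr => h _; rewrite lerBlDl. Qed.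

(* A pair [(t, g)] of [G] encodes the constraint [t <= f g] on the functional [f]
   to be constructed; every linear [f] below [tilt q G] satisfies them all. *)
Definition tilt q G x : R := inf [set q (x + g.2) - g.1 | g in G].

Section Tilt.
Variables (q : V -> R) (G : set (R * V)).
Hypotheses (qS : sublinear q) (GC : cone G)
  (qG : forall g, G g -> g.1 <= q g.2).

(** The hypothesis [qG] makes the infimum finite; on a set unbounded below, [inf] would be a default
    value. *)
Let tilt_lb x : lbound [set q (x + g.2) - g.1 | g in G] (- q (- x)).
Proof.
move=> _ [g Gg <-]; have := qG Gg; have := sublinear_ge x g.2 qS; lra.
Qed.

Let tilt_le x g : G g -> tilt q G x <= q (x + g.2) - g.1.
Proof. by move=> Gg; apply: ge_inf; [exists (- q (- x)) | exists g]. Qed.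

Let le_tilt x (M : R) : (forall g, G g -> M <= q (x + g.2) - g.1) -> M <= tilt q G x.
Proof.
move=> h; apply: lb_le_inf; last by move=> _ [g Gg <-]; exact: h.
by have [G0 _ _] := GC; exists (q (x + 0) - 0), (0, 0).
Qed.

Lemma tilt_le_sublinear x : tilt q G x <= q x.
Proof. by have [/(tilt_le x) + _ _] := GC; rewrite /= addr0 subr0. Qed.

Lemma tilt_cone g : G g -> tilt q G (- g.2) <= - g.1.
Proof. by move=> /(tilt_le (- g.2)); rewrite addNr sublinear0// sub0r. Qed.

Lemma tilt_sublinear : sublinear (tilt q G).
Proof.
have [G0 GD GZ] := GC.
have tiltZ (r : R) x : 0 < r -> tilt q G (r%:C *: x) <= r * tilt q G x.
  move=> r0; rewrite -ler_pdivrMl//; apply: le_tilt => g Gg.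
  rewrite ler_pdivrMl// mulrBr -(qS.2 _ _ (ltW r0)) scalerDr.
  exact: (tilt_le _ (GZ _ _ (ltW r0) Gg)).
split=> [x y|r x].
  rewrite -lerBlDr; apply: le_tilt => g Gg.
  rewrite lerBlDr -lerBlDl; apply: le_tilt => h Gh.
  have := tilt_le (x + y) (GD _ _ Gg Gh).
  rewrite /= addrACA; have := qS.1 (x + g.2) (y + h.2); lra.
move=> r0; have [->|rN0] := eqVneq r 0.
  rewrite rmorph0 scale0r mul0r; apply/eqP; rewrite eq_le; apply/andP; split.
    by rewrite -(sublinear0 qS); exact: tilt_le_sublinear.
  apply: le_tilt => g Gg; rewrite add0r subr_ge0; exact: qG.
have {}r0 : 0 < r by rewrite lt_def rN0.
apply/eqP; rewrite eq_le tiltZ//=.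
have := tiltZ r^-1 (r%:C *: x); rewrite invr_gt0 => /(_ r0).
rewrite scalerA -rmorphM mulVf ?gt_eqF// rmorph1 scale1r.
by rewrite ler_pdivlMl.
Qed.

End Tilt.

(** Zorn's lemma for the reversed pointwise order. The infimum of a chain is finite, every member
    being at least [- p (- x)], and subadditive because the smaller of two members can be used for
    both arguments. *)
Lemma minimal_sublinear p : sublinear p ->
  exists q, [/\ sublinear q, forall x, q x <= p x &
    forall q', sublinear q' -> (forall x, q' x <= q x) -> q' = q].
Proof.
move=> pS.
pose T := {q : V -> R | sublinear q /\ forall x, q x <= p x}.
pose D (s t : T) := `[< forall x, sval t x <= sval s x >].
have [|||A Atot|[q [qS qp]] qmin] := @Zorn T D.
- by move=> t; apply/asboolP.
- move=> r s t /asboolP rs /asboolP st; apply/asboolP => x.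
  exact: le_trans (st x) (rs x).
- move=> [s sP] [t tP] /asboolP /= st /asboolP /= ts; apply: eq_exist.
  by apply/funext => x; apply/eqP; rewrite eq_le st ts.
- have [[t0 At0]|A0] := pselect (exists t, A t); last first.
    exists (exist _ p (conj pS (fun x => lexx (p x)))) => s As.
    by case: A0; exists s.
  pose E x := [set sval t x | t in A].
  have Elb x : lbound (E x) (- p (- x)).
    move=> _ [[t [tS tp]] At <-] /=; have := sublinear_ge x 0 tS.
    by rewrite addr0 sublinear0//; have := tp (- x); lra.
  pose q x := inf (E x).
  have q_le x t : A t -> q x <= sval t x.
    by move=> At; apply: ge_inf; [exists (- p (- x)) | exists t].
  have le_q x (M : R) : (forall t, A t -> M <= sval t x) -> M <= q x.
    move=> h; apply: lb_le_inf; first by exists (sval t0 x), t0.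
    by move=> _ [t At <-]; exact: h.
  have qS : sublinear q.
    split=> [x y|r x r0].
      rewrite -lerBlDr; apply: (le_q) => s As.
      rewrite lerBlDr -lerBlDl; apply: (le_q) => t At.
      have [/asboolP st|/asboolP ts] := Atot _ _ As At.
        have := q_le (x + y) _ At; have := (svalP t).1.1 x y.
        by have := st x; lra.
      have := q_le (x + y) _ As; have := (svalP s).1.1 x y.
      by have := ts y; lra.
    apply/eqP; rewrite eq_le; apply/andP; split.
      have [->|rN0] := eqVneq r 0.
        by have := q_le (0%:C *: x) _ At0; rewrite (svalP t0).1.2// !mul0r.
      have {}r0 : 0 < r by rewrite lt_def rN0.
      rewrite -ler_pdivrMl//; apply: (le_q) => t At; rewrite ler_pdivrMl//.
      by rewrite -((svalP t).1.2 _ _ (ltW r0)) q_le.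
    apply: (le_q) => t At; rewrite (svalP t).1.2//.
    by rewrite ler_wpM2l// q_le.
  have qp x : q x <= p x by apply: le_trans (q_le x _ At0) _; exact: (svalP t0).2.
  exists (exist _ q (conj qS qp)) => s As; apply/asboolP => x /=; exact: q_le.
exists q; split => // q' q'S q'q.
have q'p x : q' x <= p x by exact: le_trans (q'q x) (qp x).
have qq' := qmin (exist _ q' (conj q'S q'p)).
by have /(congr1 sval) : _ := qq' (introT (asboolP _) q'q).
Qed.

(* Tilting [q] along the half-line of [y] gives a sublinear functional below [q]
   whose value at [- y] is at most [- q y]. *)
Lemma minimal_sublinear_additive q : sublinear q ->
  (forall q', sublinear q' -> (forall x, q' x <= q x) -> q' = q) ->
  forall x y, q (x + y) = q x + q y.
Proof.
move=> qS qmin x y.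
pose G := [set g : R * V | exists2 s, 0 <= s & g = (s * q y, s%:C *: y)].
have GC : cone G.
  split.
  - by exists 0; rewrite // mul0r scale0r.
  - move=> _ _ [s s0 ->] [t t0 ->]; exists (s + t); first by rewrite addr_ge0.
    by rewrite /= mulrDl rmorphD scalerDl.
  - move=> r _ r0 [s s0 ->]; exists (r * s); first by rewrite mulr_ge0.
    by rewrite /= mulrA scalerA rmorphM.
have qG g : G g -> g.1 <= q g.2.
  by move=> [s s0 ->] /=; rewrite qS.2.
have qE := qmin _ (tilt_sublinear qS GC qG) (tilt_le_sublinear qS GC qG).
have Gy : G (q y, y).
  by exists 1; rewrite // mul1r rmorph1 scale1r.
have qN : q (- y) <= - q y by rewrite -{1}qE; exact: (tilt_cone qS qG Gy).
have := qS.1 x y; have := qS.1 (x + y) (- y); rewrite addrK => h1 h2.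
by apply/eqP; rewrite eq_le h2/=; lra.
Qed.

(** A minimal functional below [tilt p G], rather than below [p], gets the constraints together with
    linearity. It is linear over the reals only; complex scalars are restored in [exists_state]. *)
Theorem hahn_banach_cone p G : sublinear p -> cone G ->
  (forall g, G g -> g.1 <= p g.2) ->
  exists f : V -> R,
    [/\ forall x y, f (x + y) = f x + f y,
        forall r x, f (r%:C *: x) = r * f x,
        forall x, f x <= p x & forall g, G g -> g.1 <= f g.2].
Proof.
move=> pS GC pG.
have [f [fS fp fmin]] := minimal_sublinear (tilt_sublinear pS GC pG).
have fD := minimal_sublinear_additive fS fmin.
have fN x : f (- x) = - f x.
  by apply/eqP; rewrite -addr_eq0 -fD addNr sublinear0.
exists f; split => //.
- move=> r x; have [r0|r0] := leP 0 r; first exact: fS.2.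
  have := fS.2 (- r) x; rewrite oppr_ge0 => /(_ (ltW r0)).
  by rewrite rmorphN scaleNr fN mulNr => /oppr_inj.
- by move=> x; exact: le_trans (fp x) (tilt_le_sublinear pS GC pG x).
- move=> g Gg; have := tilt_cone pS pG Gg; have := fp (- g.2); rewrite fN; lra.
Qed.

End HahnBanach.

(** * Square roots of contractions *)

Section BoundedAdditive.
Context {R : realType} {V W : completeNormedModType R[i]}.

Definition bounded_map (f : V -> W) :=
  exists M : R, forall x, nrm (f x) <= M * nrm x.

Lemma bounded_mapP (f : V -> W) : bounded_map f ->
  exists2 M : R, 0 < M & forall x, nrm (f x) <= M * nrm x.
Proof.
move=> [M fM]; exists (`|M| + 1) => [|x]; first by rewrite ltr_wpDl.
apply: le_trans (fM x) _; apply: ler_wpM2r; first exact: nrm_ge0.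
by apply: le_trans (ler_norm M) _; rewrite lerDl.
Qed.

(** Only compatibility with differences is asked, so that the conjugate-linear map sending [z] to
    [z^* y] is covered. *)
Lemma bounded_cvg (T : Type) (F : set_system T) (FF : Filter F) (f : V -> W)
    (u : T -> V) l :
  (forall x y, f (x - y) = f x - f y) -> bounded_map f ->
  u @ F --> l -> (fun t => f (u t)) @ F --> f l.
Proof.
move=> fB /bounded_mapP[M M0 fM] /cvg_nrmP ul; apply/cvg_nrmP => e e0.
have := ul (e / M) (divr_gt0 e0 M0); apply: filterS => t h.
by rewrite -fB (le_trans (fM _))// -ler_pdivlMl// mulrC.
Qed.

End BoundedAdditive.

Section CStarTheory.
Context {R : realType} {A : cstarAlgType R}.
Implicit Types (a b c x y : A).

HB.instance Definition _ a :=
  GRing.isLinear.Build R[i] A A *:%R (cmul a) (cmul_linearr a).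

Definition rmul b a : A := cmul a b.
HB.instance Definition _ b :=
  GRing.isLinear.Build R[i] A A *:%R (rmul b) (cmul_linearl b).

Lemma cmulDl a b c : cmul (a + b) c = cmul a c + cmul b c.
Proof. exact: (linearD (rmul c)). Qed.
Lemma cmulBl a b c : cmul (a - b) c = cmul a c - cmul b c.
Proof. exact: (linearB (rmul c)). Qed.
Lemma cmulNl a c : cmul (- a) c = - cmul a c.
Proof. exact: (linearN (rmul c)). Qed.
Lemma cmulZl k a c : cmul (k *: a) c = k *: cmul a c.
Proof. exact: (linearZ_LR (rmul c)). Qed.
Lemma cmul0l c : cmul 0 c = 0.
Proof. exact: (linear0 (rmul c)). Qed.

Lemma cmulDr a b c : cmul a (b + c) = cmul a b + cmul a c.
Proof. exact: (linearD (cmul a)). Qed.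
Lemma cmulBr a b c : cmul a (b - c) = cmul a b - cmul a c.
Proof. exact: (linearB (cmul a)). Qed.
Lemma cmulNr a b : cmul a (- b) = - cmul a b.
Proof. exact: (linearN (cmul a)). Qed.
Lemma cmulZr k a b : cmul a (k *: b) = k *: cmul a b.
Proof. exact: (linearZ_LR (cmul a)). Qed.
Lemma cmul0r a : cmul a 0 = 0.
Proof. exact: (linear0 (cmul a)). Qed.

Lemma cstar0 : cstar (0 : A) = 0.
Proof.
have := cstar_antilinear 1 (0 : A) 0; rewrite scaler0 addr0 rmorph1 scale1r.
by move=> h; apply: (addrI (cstar 0)); rewrite addr0 -h.
Qed.
Lemma cstarD a b : cstar (a + b) = cstar a + cstar b.
Proof. by have := cstar_antilinear 1 a b; rewrite rmorph1 !scale1r. Qed.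
Lemma cstarZ k a : cstar (k *: a) = Num.conj k *: cstar a.
Proof. by have := cstar_antilinear k a 0; rewrite cstar0 !addr0. Qed.
Lemma cstarZr (r : R) a : cstar (r%:C *: a) = r%:C *: cstar a.
Proof. by rewrite cstarZ conj_Creal// complex_real. Qed.
Lemma cstarZi a : cstar ('i *: a) = - ('i *: cstar a).
Proof. by rewrite cstarZ conjCi scaleNr. Qed.
Lemma cstarN a : cstar (- a) = - cstar a.
Proof. by rewrite -scaleN1r cstarZ rmorphN1 scaleN1r. Qed.
Lemma cstarB a b : cstar (a - b) = cstar a - cstar b.
Proof. by rewrite cstarD cstarN. Qed.

Lemma nrmM a b : nrm (cmul a b) <= nrm a * nrm b.
Proof. by rewrite -lecR rmorphM /= -!nrmE cnorm_mul. Qed.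
Lemma nrm_sq a : nrm (cmul (cstar a) a) = nrm a ^+ 2.
Proof. by apply: complexI; rewrite rmorphXn /= -!nrmE cnorm_star. Qed.

Lemma nrm_star a : nrm (cstar a) = nrm a.
Proof.
suff le b : nrm b <= nrm (cstar b).
  by apply/eqP; rewrite eq_le le andbT; have := le (cstar a); rewrite cstarK.
have [->|b0] := eqVneq (nrm b) 0; first exact: nrm_ge0.
have {}b0 : 0 < nrm b by rewrite lt_def b0 nrm_ge0.
by rewrite -(ler_pM2r b0) -expr2 -nrm_sq nrmM.
Qed.

Lemma nrm_sq_star a : nrm (cmul a (cstar a)) = nrm a ^+ 2.
Proof. by rewrite -{1}(cstarK a) nrm_sq nrm_star. Qed.

(* Elements of the unitization act on [A] by left multiplication: operators on
   [A] replace the unitization. *)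
Definition symmetric_op (T : A -> A) :=
  bounded_map T /\ forall x y, cmul (cstar (T x)) y = cmul (cstar x) (T y).

Lemma symmetric_lmul a : cstar a = a -> symmetric_op (cmul a).
Proof.
move=> aE; split; first by exists (nrm a) => x; exact: nrmM.
by move=> x y; rewrite cstarM aE cmulA.
Qed.

(** Test on [cstar a]: left multiplication is isometric even without a unit, since
    [|a|^2 = |a a^*|]. *)
Lemma nrm_lmul a (M : R) : 0 <= M ->
  (forall x, nrm (cmul a x) <= M * nrm x) -> nrm a <= M.
Proof.
move=> M0 h; have [->|a0] := eqVneq (nrm a) 0; first exact: M0.
have {}a0 : 0 < nrm a by rewrite lt_def a0 nrm_ge0.
by rewrite -(ler_pM2r a0) -expr2 -nrm_sq_star -[in leRHS]nrm_star h.
Qed.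

(** The algebra is a Hilbert module over itself for [x^* y], and [|T x|^2 = |x^* T T x|]. In
    particular [T^2 = 0] forces [T = 0]. *)
Lemma nrm_sym_sq (T : A -> A) x : symmetric_op T ->
  nrm (T x) ^+ 2 <= nrm x * nrm (T (T x)).
Proof. by case=> _ TE; rewrite -nrm_sq TE -[in leRHS]nrm_star nrmM. Qed.

Section SquareRoot.
Variable (B : {linear A -> A}).
Hypotheses (Bsym : symmetric_op B) (B1 : forall x, nrm (B x) <= nrm x).

(* The limit [S] of [S_{n+1} = (B + S_n^2) / 2] satisfies [(1 - S)^2 = 1 - B].
   The increments are dominated by those of the scalar iteration for [B = 1]. *)
Fixpoint sqrt_iter n x :=
  if n is n'.+1 then (2^-1)%:C *: (B x + sqrt_iter n' (sqrt_iter n' x)) else 0.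

Fixpoint sqrt_bound n : R :=
  if n is n'.+1 then (1 + sqrt_bound n' ^+ 2) / 2 else 0.

Lemma sqrt_iter_linear n : linear (sqrt_iter n).
Proof.
elim: n => [|n IH] k x y /=; first by rewrite scaler0 addr0.
rewrite linearP !IH scalerA mulrC -scalerA -scalerDr; congr (_ *: _).
by rewrite scalerDr addrACA.
Qed.

HB.instance Definition _ n :=
  GRing.isLinear.Build R[i] A A *:%R (sqrt_iter n) (sqrt_iter_linear n).

Lemma sqrt_bound01 n : 0 <= sqrt_bound n <= 1.
Proof.
elim: n => [|n /andP[h0 h1]] /=; first by rewrite lexx ler01.
have : sqrt_bound n ^+ 2 <= 1 by rewrite expr_le1.
have := sqr_ge0 (sqrt_bound n); lra.
Qed.

Lemma sqrt_bound_nd n : sqrt_bound n <= sqrt_bound n.+1.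
Proof.
by have := sqr_ge0 (1 - sqrt_bound n); rewrite /= sqrrB expr1n mul1r; lra.
Qed.

Lemma nrm_half x : nrm ((2^-1)%:C *: x) = nrm x / 2.
Proof. by rewrite nrmZr ger0_norm ?invr_ge0// mulrC. Qed.

Lemma sqrt_iter_bound n x : nrm (sqrt_iter n x) <= sqrt_bound n * nrm x.
Proof.
elim: n x => [|n IH] x /=; first by rewrite nrm0 mul0r.
rewrite nrm_half; have := nrmD (B x) (sqrt_iter n (sqrt_iter n x)).
have := IH (sqrt_iter n x); have := B1 x.
have /andP[h0 _] := sqrt_bound01 n; have := ler_wpM2l h0 (IH x).
rewrite mulrA -expr2; lra.
Qed.

Lemma sqrt_iter_diff n x :
  nrm (sqrt_iter n.+1 x - sqrt_iter n x)
    <= (sqrt_bound n.+1 - sqrt_bound n) * nrm x.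
Proof.
elim: n x => [|n IH] x.
  rewrite /= expr0n /= !addr0 !subr0 nrm_half mulrAC mul1r ler_pM2r ?invr_gt0//.
(* With [S = S_n] and [S' = S_{n+1}], the splitting [S'S' - SS = S'(S' - S) + (S' - S)S] avoids
   commutation. On the scalar side, [p(p - q) + (p - q)q = p^2 - q^2] is exactly twice the next
   increment of the bound. *)
have -> : sqrt_iter n.+2 x - sqrt_iter n.+1 x =
    (2^-1)%:C *: (sqrt_iter n.+1 (sqrt_iter n.+1 x - sqrt_iter n x) +
      (sqrt_iter n.+1 (sqrt_iter n x) - sqrt_iter n (sqrt_iter n x))).
  rewrite [in RHS]linearB addrA subrK.
  rewrite -[LHS]/(_ *: (B x + sqrt_iter n.+1 (sqrt_iter n.+1 x))
    - _ *: (B x + sqrt_iter n (sqrt_iter n x))).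
  by rewrite -scalerBr opprD addrACA subrr add0r.
rewrite nrm_half.
have := nrmD (sqrt_iter n.+1 (sqrt_iter n.+1 x - sqrt_iter n x))
  (sqrt_iter n.+1 (sqrt_iter n x) - sqrt_iter n (sqrt_iter n x)).
have := sqrt_iter_bound n.+1 (sqrt_iter n.+1 x - sqrt_iter n x).
have /andP[h0 _] := sqrt_bound01 n.+1; have := ler_wpM2l h0 (IH x).
have := IH (sqrt_iter n x).
have d0 : 0 <= sqrt_bound n.+1 - sqrt_bound n by rewrite subr_ge0 sqrt_bound_nd.
have := ler_wpM2l d0 (sqrt_iter_bound n x).
have -> : sqrt_bound n.+2 = (1 + sqrt_bound n.+1 ^+ 2) / 2 by [].
set p := sqrt_bound n.+1; have : p = (1 + sqrt_bound n ^+ 2) / 2 by [].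
move: (sqrt_bound n) (nrm x) => q N; nra.
Qed.

Definition sqrt_lim x := lim (sqrt_iter n x @[n --> \oo]).

Lemma sqrt_iter_cvg x : sqrt_iter n x @[n --> \oo] --> sqrt_lim x.
Proof.
apply: (@nrm_cauchy_cvg _ _ _ (fun n => sqrt_bound n * nrm x)) => [n m|].
  elim: m => [|m IH]; first by rewrite leqn0 => /eqP ->; rewrite !subrr nrm0.
  rewrite leq_eqVlt => /predU1P[->|]; first by rewrite !subrr nrm0.
  rewrite ltnS => /IH; have := sqrt_iter_diff m x.
  have := nrmD (sqrt_iter m.+1 x - sqrt_iter m x) (sqrt_iter m x - sqrt_iter n x).
  rewrite addrA subrK; lra.
exists (nrm x) => _ [n _ <-]; rewrite ler_piMl ?nrm_ge0//.
by have /andP[] := sqrt_bound01 n.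
Qed.

Lemma sqrt_iter1 n x : nrm (sqrt_iter n x) <= nrm x.
Proof.
apply: le_trans (sqrt_iter_bound n x) _; rewrite ler_piMl ?nrm_ge0//.
by have /andP[] := sqrt_bound01 n.
Qed.

Lemma sqrt_lim_linear : linear sqrt_lim.
Proof.
move=> k x y; apply: cvg_lim => //.
under eq_fun do rewrite linearP.
by apply: cvgD; [apply: cvgZr|]; exact: sqrt_iter_cvg.
Qed.

HB.instance Definition _ :=
  GRing.isLinear.Build R[i] A A *:%R sqrt_lim sqrt_lim_linear.

Lemma sqrt_lim1 x : nrm (sqrt_lim x) <= nrm x.
Proof.
apply: nrm_le_eps => e e0; have /cvg_nrmP/(_ e e0) := @sqrt_iter_cvg x.
move=> [n _ /(_ n (leqnn n)) /= h].
have := nrmB (sqrt_iter n x) (sqrt_iter n x - sqrt_lim x).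
by rewrite subKr; have := sqrt_iter1 n x; lra.
Qed.

Lemma sqrt_lim_eq x : sqrt_lim x + sqrt_lim x = B x + sqrt_lim (sqrt_lim x).
Proof.
have h1 : sqrt_iter n.+1 x @[n --> \oo] --> sqrt_lim x.
  by rewrite (cvg_shiftS (fun n => sqrt_iter n x)); exact: sqrt_iter_cvg.
have h2 : sqrt_iter n (sqrt_iter n x) @[n --> \oo] --> sqrt_lim (sqrt_lim x).
  apply/cvg_nrmP => e e0; have e20 : 0 < e / 2 by rewrite divr_gt0.
  have /cvg_nrmP/(_ _ e20) := @sqrt_iter_cvg x.
  have /cvg_nrmP/(_ _ e20) := @sqrt_iter_cvg (sqrt_lim x).
  apply: filterS2 => n h3 h4.
  have := nrmD (sqrt_iter n (sqrt_iter n x - sqrt_lim x))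
    (sqrt_iter n (sqrt_lim x) - sqrt_lim (sqrt_lim x)).
  rewrite [sqrt_iter n (_ - _)]linearB addrA subrK.
  have := sqrt_iter1 n (sqrt_iter n x - sqrt_lim x).
  rewrite [sqrt_iter n (_ - _)]linearB; lra.
have h3 : sqrt_iter n.+1 x @[n --> \oo] -->
    (2^-1)%:C *: (B x + sqrt_lim (sqrt_lim x)).
  by apply: cvgZr; apply: cvgD => //; exact: cvg_cst.
have {h1 h2 h3}limE : sqrt_lim x = (2^-1)%:C *: (B x + sqrt_lim (sqrt_lim x)).
  exact: cvg_unique h1 h3.
rewrite {1 2}limE -scalerDl -rmorphD.
have -> : 2^-1 + 2^-1 = 1 :> R by lra.
by rewrite rmorph1 scale1r.
Qed.

Lemma sqrt_lim_comm (U : {linear A -> A}) : bounded_map U ->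
  (forall x, U (B x) = B (U x)) -> forall x, U (sqrt_lim x) = sqrt_lim (U x).
Proof.
move=> Ub UB x; apply/esym/cvg_lim => //.
under eq_fun => n.
  have -> : sqrt_iter n (U x) = U (sqrt_iter n x).
    elim: n x => [|n IH] x /=; first by rewrite linear0.
    by rewrite -UB !IH -linearD -linearZ_LR.
  over.
by apply: bounded_cvg => //; [exact: linearB | exact: sqrt_iter_cvg].
Qed.

Lemma sqrt_lim_symmetric : symmetric_op sqrt_lim.
Proof.
split; first by exists 1 => x; rewrite mul1r sqrt_lim1.
move=> x y.
have iter_sym n u v :
    cmul (cstar (sqrt_iter n u)) v = cmul (cstar u) (sqrt_iter n v).
  elim: n u v => [|n IH] u v /=; first by rewrite cstar0 cmul0l cmul0r.
  by rewrite cstarZr cmulZl cmulZr cstarD cmulDl cmulDr Bsym.2 !IH.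
have h1 : cmul (cstar (sqrt_iter n x)) y @[n --> \oo]
    --> cmul (cstar (sqrt_lim x)) y.
  apply: (@bounded_cvg _ _ _ _ _ _ (fun z => cmul (cstar z) y)).
  - by move=> u v; rewrite cstarB cmulBl.
  - by exists (nrm y) => z; rewrite mulrC -[nrm z]nrm_star nrmM.
  - exact: sqrt_iter_cvg.
have h2 : cmul (cstar x) (sqrt_iter n y) @[n --> \oo]
    --> cmul (cstar x) (sqrt_lim y).
  apply: (@bounded_cvg _ _ _ _ _ _ (cmul (cstar x)));
    [exact: linearB | | exact: sqrt_iter_cvg].
  by exists (nrm (cstar x)) => z; exact: nrmM.
move: h1; under eq_fun do rewrite iter_sym.
by move=> h1; exact: cvg_unique h1 h2.
Qed.

Lemma contraction_sqrt : exists S : {linear A -> A},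
  [/\ symmetric_op S, forall x, nrm (S x) <= nrm x,
      forall x, S x + S x = B x + S (S x) &
      forall U : {linear A -> A}, bounded_map U ->
        (forall x, U (B x) = B (U x)) -> forall x, U (S x) = S (U x)].
Proof.
exists sqrt_lim; split; [exact: sqrt_lim_symmetric | exact: sqrt_lim1
  | exact: sqrt_lim_eq | exact: sqrt_lim_comm].
Qed.

End SquareRoot.
End CStarTheory.

(** * Positive operators on the algebra *)

Lemma sqr_le_nonneg (R : realDomainType) (a b : R) :
  0 <= b -> a ^+ 2 <= b ^+ 2 -> a <= b.
Proof.
move=> b0 ab; rewrite leNgt; apply/negP => ba; move: ab; apply/negP.
by rewrite -ltNge ltr_pXn2r// nnegrE// ltW// (le_lt_trans b0).
Qed.

Section Positivity.
Context {R : realType} {A : cstarAlgType R}.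
Implicit Types (a b c x y : A) (f g h k T U : {linear A -> A}).

(* [T] has its spectrum in [[0, 2t]].  In this form sums are trivially positive. *)
Definition positive_op (T : A -> A) := symmetric_op T /\
  exists2 t : R, 0 < t & forall x, nrm (t%:C *: x - T x) <= t * nrm x.

Lemma scale2C x : 2%:C *: x = x + x.
Proof. by rewrite -[2]/(1 + 1) rmorphD rmorph1 scalerDl scale1r. Qed.

Lemma bounded_lmul a : bounded_map (cmul a).
Proof. by exists (nrm a) => x; exact: nrmM. Qed.

Lemma bounded_rmul b : bounded_map (rmul b).
Proof. by exists (nrm b) => x; rewrite mulrC; exact: nrmM. Qed.

Lemma symmetric_id : symmetric_op (@idfun A).
Proof. by split => //; exists 1 => x; rewrite mul1r. Qed.

Lemma symmetricD (f g : A -> A) : symmetric_op f -> symmetric_op g ->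
  symmetric_op (f \+ g).
Proof.
move=> [[M fM] fE] [[N gN] gE]; split.
  exists (M + N) => x; rewrite mulrDl; apply: le_trans (nrmD _ _) _.
  exact: lerD.
by move=> x y; rewrite /= cstarD cmulDl cmulDr fE gE.
Qed.

Lemma symmetricZ (r : R) (f : A -> A) : symmetric_op f -> symmetric_op (r%:C \*: f).
Proof.
move=> [[M fM] fE]; split.
  by exists (`|r| * M) => x; rewrite nrmZr -mulrA ler_wpM2l.
by move=> x y; rewrite /= cstarZr cmulZl cmulZr fE.
Qed.

Lemma symmetricN (f : A -> A) : symmetric_op f -> symmetric_op (\- f).
Proof.
move=> [[M fM] fE]; split; first by exists M => x; rewrite nrmN.
by move=> x y; rewrite /= cstarN cmulNl cmulNr fE.
Qed.

Lemma symmetricB (f g : A -> A) : symmetric_op f -> symmetric_op g ->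
  symmetric_op (f \- g).
Proof. by move=> fS gS; exact: (symmetricD fS (symmetricN gS)). Qed.

Lemma symmetric_comp (f g : A -> A) : symmetric_op f -> symmetric_op g ->
  (forall x, f (g x) = g (f x)) -> symmetric_op (f \o g).
Proof.
move=> [fb fE] [gb gE] fg; split.
  have [M M0 fM] := bounded_mapP fb; have [N N0 gN] := bounded_mapP gb.
  exists (M * N) => x /=; apply: le_trans (fM _) _.
  by rewrite -mulrA ler_wpM2l// ltW.
by move=> x y; rewrite /= fE gE fg.
Qed.

Lemma positive_ext (f g : A -> A) : f =1 g -> positive_op f -> positive_op g.
Proof. by move=> /funext ->. Qed.

Lemma positiveD (f g : A -> A) : positive_op f -> positive_op g ->
  positive_op (f \+ g).
Proof.
move=> [fS [s s0 fs]] [gS [t t0 gt]]; split; first exact: symmetricD.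
exists (s + t) => [|x]; first exact: addr_gt0.
rewrite rmorphD scalerDl /= opprD addrACA mulrDl.
by apply: le_trans (nrmD _ _) _; exact: lerD.
Qed.

Lemma positiveZ (r : R) (f : A -> A) : 0 <= r -> positive_op f ->
  positive_op (r%:C \*: f).
Proof.
move=> r0 [fS [t t0 ft]]; split; first exact: symmetricZ.
have [->|rN0] := eqVneq r 0.
  exists 1 => // x; rewrite rmorph0 /= scale0r subr0 rmorph1 scale1r.
  by rewrite mul1r.
have {}r0 : 0 < r by rewrite lt_def rN0.
exists (r * t) => [|x]; first exact: mulr_gt0.
rewrite rmorphM -scalerA -scalerBr nrmZr gtr0_norm// -mulrA.
by rewrite ler_wpM2l// ltW.
Qed.

(** With [|t - T| <= t], the operator [B = 1 - T/t] is a contraction and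
    [T = t (1 - B) = t (1 - S)^2]. The root [sqrt t (1 - S)] is positive with constant [sqrt t]
    because [|S| <= 1]. *)
Lemma positive_sqrt T : positive_op T -> exists G : {linear A -> A},
  [/\ positive_op G, forall x, G (G x) = T x &
    forall U, bounded_map U -> (forall x, U (T x) = T (U x)) ->
      forall x, U (G x) = G (U x)].
Proof.
move=> [TS [t t0 Tt]].
pose B : {linear A -> A} := idfun \- ((t^-1)%:C \*: T).
have BS : symmetric_op B.
  by apply: symmetricB; [exact: symmetric_id | exact: symmetricZ].
have tV (x : A) : t%:C *: ((t^-1)%:C *: x) = x.
  by rewrite scalerA -rmorphM mulfV ?gt_eqF// rmorph1 scale1r.
have BE x : t%:C *: B x = t%:C *: x - T x by rewrite /= scalerBr tV.
have B1 x : nrm (B x) <= nrm x.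
  by rewrite -(ler_pM2l t0); have := Tt x; rewrite -BE nrmZr gtr0_norm.
pose s : R := Num.sqrt t; have s0 : 0 <= s by exact: sqrtr_ge0.
have sE : s * s = t by rewrite -expr2 sqr_sqrtr// ltW.
have [S [SS S1 SE SC]] := contraction_sqrt BS B1.
exists (s%:C \*: (idfun \- S)); split.
- split; first by apply/symmetricZ/symmetricB => //; exact: symmetric_id.
  exists s => [|x]; first by rewrite sqrtr_gt0.
  by rewrite /= -scalerBr subKr nrmZr ger0_norm// ler_wpM2l.
- move=> x /=; rewrite [S (_ *: _)]linearZ_LR -scalerBr scalerA -rmorphM sE.
  have -> : x - S x - S (x - S x) = x - B x.
    have -> : B x = S x + S x - S (S x) by rewrite SE addrK.
    by rewrite linearB -[S x + S x - _]addrA [in RHS]opprD addrA.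
  by rewrite scalerBr BE subKr.
- move=> U Ub UT x; rewrite linearZ_LR linearB /= SC// => z.
  by rewrite /= linearB linearZ_LR UT.
Qed.

(** By commutation the cross terms cancel and [u = f + ig] has [u^* u = f^2 + g^2]; the norm
    identity of the algebra is then applied to [u x]. *)
Lemma sum_sq_ge f g (M : R) : symmetric_op f -> symmetric_op g ->
  (forall x, f (g x) = g (f x)) ->
  (forall x, nrm (f (f x) + g (g x)) <= M * nrm x) ->
  forall x, nrm (f x + 'i *: g x) ^+ 2 <= M * nrm x ^+ 2.
Proof.
move=> fS gS fg hM x; rewrite -nrm_sq.
set u := f x + _.
have -> : cmul (cstar u) u = cmul (cstar x) (f (f x) + g (g x)).
  rewrite [in LHS]/u cstarD cstarZi cmulDl cmulNl cmulZl fS.2 gS.2 -cmulZr -cmulBr.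
  congr (cmul _ _); rewrite /u !linearD !linearZ_LR /=.
  by rewrite scalerA -expr2 sqrCi scaleN1r opprK fg scalerN addrA addrK.
apply: le_trans (nrmM _ _) _; rewrite nrm_star mulrC expr2 mulrA.
by rewrite ler_wpM2r// nrm_ge0.
Qed.

(* If [W] is the square root of [1 - f^2], then [u = f + iW] is unitary and
   [u^2 + u^{*2} = 2 (2 f^2 - 1)]. *)
Lemma contraction_sub_sq f : symmetric_op f -> (forall x, nrm (f x) <= nrm x) ->
  forall x, nrm (x - (f (f x) + f (f x))) <= nrm x.
Proof.
move=> fS f1.
have ffS : symmetric_op (f \o f) by exact: symmetric_comp.
have [|W [[WS _] WE WC]] := @positive_sqrt (idfun \- (f \o f)).
  split; first by apply: symmetricB => //; exact: symmetric_id.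
  exists 1 => // x; rewrite /= rmorph1 scale1r subKr mul1r.
  by apply: le_trans (f1 _) (f1 _).
have fW x : f (W x) = W (f x) by apply: WC fS.1 _ x => y /=; rewrite linearB.
have sumE x : f (f x) + W (W x) = x by rewrite WE /= addrC subrK.
have u1 x : nrm (f x + 'i *: W x) <= nrm x.
  apply: sqr_le_nonneg (nrm_ge0 _) _.
  rewrite -[leRHS]mul1r; apply: sum_sq_ge => // z.
  by rewrite sumE mul1r.
have v1 x : nrm (f x - 'i *: W x) <= nrm x.
  apply: sqr_le_nonneg (nrm_ge0 _) _.
  rewrite -[leRHS]mul1r -scalerN.
  apply: (@sum_sq_ge f (\- W)) => //= [|z|z].
  - exact: symmetricN.
  - by rewrite linearN fW.
  - by rewrite linearN opprK sumE mul1r.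
move=> x.
have := nrmD (f (f x + 'i *: W x) + 'i *: W (f x + 'i *: W x))
  (f (f x - 'i *: W x) - 'i *: W (f x - 'i *: W x)).
have -> : f (f x + 'i *: W x) + 'i *: W (f x + 'i *: W x) +
    (f (f x - 'i *: W x) - 'i *: W (f x - 'i *: W x)) =
    - (2%:C *: (x - (f (f x) + f (f x)))).
  have cross a1 a2 b1 b2 : a1 + b1 + (b2 - a2) + (a1 - b1 + (- b2 - a2)) =
      (a1 - a2) + (a1 - a2).
    rewrite [LHS]addrACA (addrACA a1 b1) subrr addr0 (addrACA b2 (- a2)) subrr.
    by rewrite add0r addrACA.
  have -> : x - (f (f x) + f (f x)) = - (f (f x) - W (W x)).
    by rewrite WE /= !opprB opprD addrAC addrA.
  rewrite scale2C opprD opprK.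
  rewrite !linearD !linearN !linearZ_LR /=.
  rewrite !scalerA -!expr2 sqrCi !scaleN1r !opprK !scalerN.
  exact: cross.
rewrite nrmN nrmZr ger0_norm//.
have := u1 (f x + 'i *: W x); have := u1 x.
have := v1 (f x - 'i *: W x); have := v1 x; lra.
Qed.

(** Rescaled by [M^-1], [f] is a contraction, and [|1 - 2 f^2/M^2| <= 1] is positivity with
    [t = M^2/2]. *)
Lemma positive_sq f : symmetric_op f -> positive_op (f \o f).
Proof.
move=> fS; split; first exact: symmetric_comp.
have [M M0 fM] := bounded_mapP fS.1.
have := @contraction_sub_sq ((M^-1)%:C \*: f) (symmetricZ _ fS).
move=> /(_ _)/wrap[x|h]; first by rewrite nrmZr gtr0_norm ?invr_gt0// ler_pdivrMl.
have t0 : 0 < M ^+ 2 / 2 by rewrite divr_gt0// exprn_gt0.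
exists (M ^+ 2 / 2) => // x.
have := h x; rewrite -(ler_pM2l t0) -{1}(gtr0_norm t0) -nrmZr.
congr (nrm _ <= _); rewrite scalerBr; congr (_ - _).
rewrite /= linearZ_LR -scalerDl !scalerA -!rmorphD -!rmorphM.
have -> : M ^+ 2 / 2 * (M^-1 + M^-1) * M^-1 = 1 by field; rewrite gt_eqF.
by rewrite rmorph1 scale1r.
Qed.

(* If [h = g^2] and [m - h = f^2], then [g + if] and [g - if] have norm at most
   [sqrt m], hence so has [g]. *)
Lemma nrm_le_of_positive h (m : R) : positive_op h ->
  positive_op ((m%:C \*: idfun) \- h) -> 0 <= m ->
  forall x, nrm (h x) <= m * nrm x.
Proof.
move=> hP mhP m0 x.
have [g [[gS _] gE gC]] := positive_sqrt hP.
have [f [[fS _] fE fC]] := positive_sqrt mhP.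
have hf y : h (f y) = f (h y).
  by apply: fC hP.1.1 _ y => z; rewrite /= linearB linearZ_LR.
have fg y : f (g y) = g (f y) by apply: gC fS.1 _ y => z; rewrite hf.
have gM y : nrm (g y) ^+ 2 <= m * nrm y ^+ 2.
  have H (e : {linear A -> A}) : symmetric_op e -> (forall z, e (e z) = f (f z)) ->
    (forall z, g (e z) = e (g z)) -> nrm (g y + 'i *: e y) ^+ 2 <= m * nrm y ^+ 2.
    move=> eS eE ge; apply: sum_sq_ge => // z.
    by rewrite gE eE fE /= addrC subrK nrmZr ger0_norm.
  have h1 := H f fS (fun=> erefl) (fun z => esym (fg z)).
  have h2 : nrm (g y - 'i *: f y) ^+ 2 <= m * nrm y ^+ 2.
    rewrite -scalerN; apply: (H (\- f)) => /= [|z|z].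
    - exact: symmetricN.
    - by rewrite linearN opprK.
    - by rewrite linearN fg.
  have := nrmD (g y + 'i *: f y) (g y - 'i *: f y).
  rewrite addrACA subrr addr0 -mulr2n -scaler_nat -(rmorph_nat (real_complex R)).
  rewrite nrmZr ger0_norm// => h3.
  have := nrm_ge0 (g y); move: h1 h2 h3.
  move: (nrm (g y + _)) (nrm (g y - _)) (nrm (g y)) (m * _) => p q r s h1 h2 h3 r0.
  (* From [2r <= p + q] and [(p + q)^2 <= 2 (p^2 + q^2) <= 4s]. *)
  have := sqr_ge0 (p - q).
  have : 0 <= (p + q - 2 * r) * (p + q + 2 * r) by apply: mulr_ge0; lra.
  nra.
apply: sqr_le_nonneg; first by rewrite mulr_ge0 ?nrm_ge0.
rewrite -gE; apply: le_trans (gM _) _; rewrite exprMn [m ^+ 2]expr2 -mulrA.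
by rewrite ler_wpM2l.
Qed.

(** [M - h = (M - (h + k)) + k] is a sum of positive operators. This is the monotonicity of the
    norm. *)
Lemma nrm_le_add_positive h k (M : R) : positive_op h -> positive_op k ->
  0 <= M -> (forall x, nrm (h x + k x) <= M * nrm x) ->
  forall x, nrm (h x) <= M * nrm x.
Proof.
move=> hP kP M0 hkM; apply: nrm_le_of_positive => //.
have sumP : positive_op ((M%:C \*: idfun) \- (h \+ k)).
  split.
    apply: symmetricB; first exact/symmetricZ/symmetric_id.
    by apply: symmetricD; [case: hP | case: kP].
  (* [M] itself satisfies the bound, but the constant has to be positive and [M] may vanish. *)
  exists (M + 1) => [|x]; first by rewrite ltr_wpDl.
  rewrite /= opprB rmorphD scalerDl rmorph1 scale1r addrC addrA subrK mulrDl mul1r.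
  by apply: le_trans (nrmD _ _) _; rewrite lerD2r.
apply: positive_ext (positiveD sumP kP) => x /=.
by rewrite opprD addrA subrK.
Qed.

(* With [k = - c^*c], the identity [c (t + k) = t c - c c^* c] bounds
   [k (t + k) = (k + t/2)^2 - t^2/4] by [t |k|], which [k >= 0] only allows when
   [k = 0]. *)
Lemma eq0_of_neg_star_mul c :
  positive_op (fun x => - cmul (cmul (cstar c) c) x) ->
  positive_op (cmul (cmul c (cstar c))) -> c = 0.
Proof.
move=> kP [_ [t t0 lt]].
pose k : {linear A -> A} := \- cmul (cmul (cstar c) c).
have {}kP : positive_op k by [].
pose mu := nrm c ^+ 2; have mu0 : 0 <= mu by exact: sqr_ge0.
have k_shift x : nrm (k (t%:C *: x + k x)) <= t * mu * nrm x.
  have cE : cmul c (t%:C *: x + k x) =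
      t%:C *: cmul c x - cmul (cmul c (cstar c)) (cmul c x).
    by rewrite cmulDr cmulZr /= cmulNr !cmulA.
  rewrite /= nrmN -cmulA cE; apply: le_trans (nrmM _ _) _; rewrite nrm_star.
  have := ler_wpM2l (nrm_ge0 c) (lt (cmul c x)).
  have := ler_wpM2l (ltW t0) (ler_wpM2l (nrm_ge0 c) (nrmM c x)).
  rewrite /mu; move: (nrm c) (nrm x) (nrm (cmul c x)) => *; nra.
pose g : {linear A -> A} := k \+ ((t / 2)%:C \*: idfun).
have gS : symmetric_op g.
  by apply: symmetricD; [case: kP | exact/symmetricZ/symmetric_id].
have t20 : 0 <= t / 2 by rewrite divr_ge0// ltW.
pose r : R := Num.sqrt (t * mu + (t / 2) ^+ 2).
have r2 : r ^+ 2 = t * mu + (t / 2) ^+ 2.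
  by rewrite sqr_sqrtr// addr_ge0 ?sqr_ge0// mulr_ge0// ltW.
have r0 : t / 2 <= r.
  apply: sqr_le_nonneg; first exact: sqrtr_ge0.
  by rewrite r2 lerDr mulr_ge0// ltW.
have g_le x : nrm (g x) <= r * nrm x.
  apply: sqr_le_nonneg; first by rewrite mulr_ge0 ?nrm_ge0 ?sqrtr_ge0.
  apply: le_trans (nrm_sym_sq x gS) _.
  have -> : g (g x) = k (t%:C *: x + k x) + ((t / 2) ^+ 2)%:C *: x.
    rewrite -[LHS]/(k (k x + (t / 2)%:C *: x)
      + (t / 2)%:C *: (k x + (t / 2)%:C *: x)).
    rewrite !linearD !linearZ_LR /= addrA -[_ + _ + _ *: k x]addrA -scalerDl.
    rewrite -rmorphD.
    by rewrite -splitr [k (k x) + _]addrC scalerA -rmorphM -expr2.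
  rewrite [leRHS]exprMn r2 [nrm x ^+ 2]expr2 mulrA [leRHS]mulrC ler_wpM2l ?nrm_ge0//.
  apply: le_trans (nrmD _ _) _.
  by rewrite mulrDl lerD// nrmZr ger0_norm// sqr_ge0.
(* [r - ((r - t/2) - k) = g] has norm at most [r], so [(r - t/2) - k] is positive. *)
have k_le x : nrm (k x) <= (r - t / 2) * nrm x.
  apply: nrm_le_of_positive => //; last by rewrite subr_ge0.
  split.
    by apply: symmetricB; [exact/symmetricZ/symmetric_id | case: kP].
  exists r => [|z]; first by apply: lt_le_trans r0; rewrite divr_gt0.
  have -> : r%:C *: z - ((r - t / 2)%:C \*: idfun \- k) z = g z.
    rewrite -[LHS]/(r%:C *: z - ((r - t / 2)%:C *: z - k z)).
    by rewrite opprB addrCA -scalerBl -rmorphB subKr.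
  exact: g_le.
have mu_le : mu <= r - t / 2.
  rewrite /mu -nrm_sq; apply: nrm_lmul => [|x]; first by rewrite subr_ge0.
  by have := k_le x; rewrite /= nrmN.
(* Squaring [mu + t/2 <= r] leaves [mu^2 <= 0]. *)
have mu_0 : mu = 0 by apply/eqP; nra.
by apply: nrm0_eq0; apply/eqP; rewrite -sqrf_eq0 -/mu mu_0.
Qed.

(* Kaplansky's argument: for [h = b^*b], [w = sqrt (h^2)] and [y = w - h], the
   element [c = by] satisfies [c^*c = yhy = - ywy], so that [c = 0] by the previous
   lemma, whence [y = 0]. *)
Lemma positive_lmul_star b : positive_op (cmul (cmul (cstar b) b)).
Proof.
set h := cmul (cstar b) b.
have hE : cstar h = h by rewrite cstarM cstarK.
have hS := symmetric_lmul hE.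
have [w [wP wE wC]] := positive_sqrt (positive_sq hS).
have [v [[vS _] vE vC]] := positive_sqrt wP.
have wh x : cmul h (w x) = w (cmul h x) by apply: wC (bounded_lmul h) _ x.
(* [w] commutes with right multiplications because left multiplications do; it behaves like an
   element of the unitization, which gives [yr] below. *)
have wr z x : rmul z (w x) = w (rmul z x).
  by apply: wC (bounded_rmul z) _ x => y; rewrite /rmul /= !cmulA.
have vh x : cmul h (v x) = v (cmul h x).
  by apply: vC (bounded_lmul h) _ x => y; exact: wh.
have vw x : w (v x) = v (w x) by apply: vC wP.1.1 _ x.
pose y : {linear A -> A} := w \- cmul h.
have yS : symmetric_op y by apply: symmetricB => //; case: wP.
(* [w^2 = h^2] gives [(w - h) h = w h - w^2 = - (w - h) w]. *)
have yh x : y (cmul h x) = - y (w x).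
  have := wE x; rewrite /y /= wh => ->;
  by rewrite opprB.
have vy x : v (y x) = y (v x) by rewrite /y /= linearB /= vw vh.
pose q : {linear A -> A} := v \o y.
have qS : symmetric_op q by exact: symmetric_comp.
have wy x : w (y x) = y (w x) by rewrite /y /= linearB /= wh.
have yhy x : y (cmul h (y x)) = - q (q x).
  by rewrite yh -[q (q x)]/(v (y (v (y x)))) vy vE.
(* [y] is an operator, so [by] is defined through its adjoint, where [y] acts on the element
   [b^*]. *)
pose c := cstar (y (cstar b)).
have cE x : cmul c x = cmul b (y x) by rewrite /c yS.2 cstarK.
have ccE x : cmul (cmul (cstar c) c) x = - q (q x).
  rewrite -cmulA cE /c cstarK -yhy /h -!cmulA.
  have yr z u : cmul (y u) z = y (cmul u z).
    by rewrite /y /= cmulBl -cmulA; congr (_ - _); exact: wr.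
  by rewrite yr.
have c0 : c = 0.
  apply: eq0_of_neg_star_mul.
    by apply: positive_ext (positive_sq qS) => x; rewrite ccE opprK.
  (* Up to sign, [p1] and [p2] are twice the real and imaginary parts of [c], so
     [c c^* = (p1^2 + p2^2)/2 - c^* c], where [- c^* c] acts as [q^2]. *)
  pose p1 := c + cstar c; pose p2 := 'i *: (c - cstar c).
  have p1E : cstar p1 = p1 by rewrite cstarD cstarK addrC.
  have p2E : cstar p2 = p2 by rewrite cstarZi cstarB cstarK -scalerN opprB.
  have half0 : (0 : R) <= 2^-1 by rewrite invr_ge0.
  have := positiveD (positiveZ half0
    (positiveD (positive_sq (symmetric_lmul p1E))
      (positive_sq (symmetric_lmul p2E))))
    (positive_sq qS).
  have p12 : cmul p1 p1 + cmul p2 p2 = 2%:C *: (cmul (cstar c) c + cmul c (cstar c)).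
    rewrite cmulZl cmulZr scalerA -expr2 sqrCi scaleN1r scale2C.
    rewrite !cmulDl !cmulDr !cmulNl !cmulNr !opprD !opprK.
    move: (cmul c c) (cmul c (cstar c)) (cmul (cstar c) c)
      (cmul (cstar c) (cstar c)).
    move=> a1 a2 a3 a4.
    rewrite [LHS]addrACA (addrACA a1 a2) subrr add0r (addrACA a3 a4) subrr addr0.
    by rewrite addrACA (addrC a2).
  apply: positive_ext => x /=; rewrite !cmulA -cmulDl p12 cmulZl scalerA -rmorphM.
  by rewrite mulVf// rmorph1 scale1r cmulDl ccE /= addrAC addNr add0r.
have qq0 x : q (q x) = 0 by apply: oppr_inj; rewrite -ccE c0 cmul0r cmul0l oppr0.
have q0 x : q x = 0.
  apply: nrm0_eq0; apply/eqP; rewrite -sqrf_eq0 eq_le sqr_ge0 andbT.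
  by apply: le_trans (nrm_sym_sq x qS) _; rewrite qq0 nrm0 mulr0.
have wy0 x : w (y x) = 0.
  by have := q0 x; rewrite -vE /q /= => ->; rewrite linear0.
have y0 x : y x = 0.
  apply: nrm0_eq0; apply/eqP; rewrite -sqrf_eq0 eq_le sqr_ge0 andbT.
  apply: le_trans (nrm_sym_sq x yS) _.
  have -> : y (y x) = y (w x) - y (cmul h x) by rewrite -linearB.
  by rewrite yh -wy wy0 oppr0 subr0 nrm0 mulr0.
by apply: positive_ext wP => x; apply/eqP; rewrite -subr_eq0 -[_ - _]/(y x) y0.
Qed.

End Positivity.

(** * Existence of states *)

Section States.
Context {R : realType} {A : cstarAlgType R}.
Implicit Types (a b x y : A).

Definition re_part x : A := (2^-1)%:C *: (x + cstar x).

Lemma re_part_id x : cstar x = x -> re_part x = x.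
Proof.
move=> xE; rewrite /re_part xE -scale2C scalerA -rmorphM mulVf//.
by rewrite rmorph1 scale1r.
Qed.

Lemma re_partD x y : re_part (x + y) = re_part x + re_part y.
Proof. by rewrite /re_part cstarD addrACA scalerDr. Qed.

Lemma re_partZ (r : R) x : re_part (r%:C *: x) = r%:C *: re_part x.
Proof. by rewrite /re_part cstarZr -scalerDr !scalerA mulrC. Qed.

Lemma nrm_re_part x : nrm (re_part x) <= nrm x.
Proof.
rewrite nrmZr ger0_norm ?invr_ge0//; have := nrmD x (cstar x).
by rewrite nrm_star; lra.
Qed.

Lemma re_part_i x : cstar x = x -> re_part ('i *: x) = 0.
Proof. by move=> xE; rewrite /re_part cstarZi xE subrr scaler0. Qed.

(** Taking [|Re x|] rather than [|x|] as the majorant forces the functional to vanish on [i x] for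
    self-adjoint [x]; its complexification is then real on positive elements. *)
Lemma sublinear_nrm_re : sublinear (fun x : A => nrm (re_part x)).
Proof.
split=> [x y|r x r0]; first by rewrite re_partD nrmD.
by rewrite re_partZ nrmZr ger0_norm.
Qed.

Lemma cpos_star a : cpos a -> cstar a = a.
Proof. by move=> [b ->]; rewrite cstarM cstarK. Qed.

(** The pairs [(0, a)] make the Hahn-Banach functional [f] positive, and [f a - i f (i a)]
    complexifies it. The factor [c] is the inverse of the norm [m] of the latter, nonzero by the
    pair [g0]. *)
Lemma exists_state (G : set (R * A)) : cone G ->
  (forall g, G g -> cstar g.2 = g.2) -> (forall g, G g -> g.1 <= nrm g.2) ->
  (forall a, cpos a -> G (0, a)) -> (exists2 g, G g & 0 < g.1) ->
  exists2 psi : A -> R[i], state psi &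
    exists2 c : R, 0 < c & forall g, G g -> c * g.1 <= complex.Re (psi g.2).
Proof.
move=> GC Gsa Gn Gpos [g0 Gg0 g00].
have [|f [fD fZ f_le Gf]] := hahn_banach_cone sublinear_nrm_re GC.
  by move=> g Gg; rewrite re_part_id ?Gsa ?Gn.
have fN x : f (- x) = - f x.
  by have := fZ (-1) x; rewrite rmorphN1 scaleN1r mulN1r.
have f_nrm x : `|f x| <= nrm x.
  rewrite ler_norml lerNl -fN; apply/andP; split.
    by rewrite -(nrmN x); exact: le_trans (f_le _) (nrm_re_part _).
  exact: le_trans (f_le _) (nrm_re_part _).
have f_i x : cstar x = x -> f ('i *: x) = 0.
  move=> xE; apply/eqP; rewrite eq_le.
  have := f_le ('i *: x); rewrite re_part_i// nrm0 => ->/=.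
  have := f_le ('i *: - x); rewrite re_part_i ?cstarN ?xE// nrm0.
  by rewrite scalerN fN oppr_le0.
pose Phi a : R[i] := Complex (f a) (- f ('i *: a)).
have PhiD x y : Phi (x + y) = Phi x + Phi y.
  by rewrite /Phi scalerDr !fD opprD.
have PhiZr (r : R) x : Phi (r%:C *: x) = r%:C * Phi x.
  rewrite /Phi scalerA mulrC -scalerA !fZ; apply/eqP.
  by rewrite eq_complex /= !mul0r subr0 addr0 mulrN !eqxx.
have PhiZi x : Phi ('i *: x) = 'i * Phi x.
  rewrite /Phi scalerA -expr2 sqrCi scaleN1r fN opprK -complexiE; apply/eqP.
  by rewrite eq_complex /= !mul0r !mul1r sub0r opprK add0r !eqxx.
have Phi_scalar : scalar Phi.
  move=> k x y; rewrite PhiD; congr (_ + _).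
  rewrite {1 2}[k]complexE complexiE scalerDl -scalerA PhiD PhiZr PhiZi PhiZr.
  by rewrite mulrDl mulrA.
(* The factor [2] is crude; it only has to make the supremum [m] a genuine one. *)
have Phi_nrm a : complex.Re `|Phi a| <= 2 * nrm a.
  rewrite -lecR RRe_real ?normr_real// [Phi a]complexE complexiE /=.
  apply: le_trans (ler_normD _ _) _; rewrite normrM normCi mul1r.
  rewrite !normc_def /= !expr0n /= !addr0 !sqrtr_sqr normrN -rmorphD /= lecR.
  by have := f_nrm a; have := f_nrm ('i *: a); rewrite nrmZi; lra.
have Re_le (z : R[i]) : complex.Re z <= complex.Re `|z|.
  rewrite normc_def /=; apply: le_trans (ler_norm _) _.
  by rewrite -sqrtr_sqr ler_wsqrtr// lerDl sqr_ge0.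
pose E := [set complex.Re `|Phi a| | a in [set a : A | `|a| <= 1]].
have E_ub : has_ubound E.
  exists 2 => _ [a a1 <-]; apply: le_trans (Phi_nrm a) _.
  by rewrite ger_pMr// -lecR -nrmE.
pose m : R := sup E.
have E_le a : `|a| <= 1 -> complex.Re `|Phi a| <= m.
  by move=> a1; apply: ub_le_sup => //; exists a.
have E0 : E !=set0 by exists (complex.Re `|Phi 0|), 0; rewrite //= normr0.
have m0 : 0 < m.
  have fg0 : 0 < f g0.2 := lt_le_trans g00 (Gf _ Gg0).
  have ng0 : 0 < nrm g0.2 := lt_le_trans g00 (Gn _ Gg0).
  apply: (@lt_le_trans _ _ (f ((nrm g0.2)^-1%:C *: g0.2))).
    by rewrite fZ mulr_gt0// invr_gt0.
  apply: le_trans (Re_le (Phi _)) (E_le _ _).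
  by rewrite nrmE nrmZr gtr0_norm ?invr_gt0// mulVf ?gt_eqF.
pose psi a := (m^-1)%:C * Phi a.
have psi_norm a : complex.Re `|psi a| = m^-1 * complex.Re `|Phi a|.
  rewrite normrM [`|(m^-1)%:C|]ger0_norm ?ler0c ?invr_ge0 ?ltW//.
  by case: `|Phi a| => u v /=; rewrite mul0r subr0.
have psi_re a : complex.Re (psi a) = m^-1 * f a.
  by rewrite /psi /Phi /= mul0r subr0.
exists psi; last first.
  exists m^-1; first by rewrite invr_gt0.
  by move=> g Gg; rewrite psi_re ler_pM2l ?invr_gt0// Gf.
split.
- by move=> k x y; rewrite /psi Phi_scalar mulrDr mulrCA.
- move=> a apos; have fa : 0 <= f a := Gf _ (Gpos _ apos).
  rewrite /psi /Phi f_i ?cpos_star// oppr0 -[Complex _ 0]/((f a)%:C) -rmorphM.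
  by rewrite ler0c mulr_ge0// invr_ge0 ltW.
- rewrite /functional_norm; set F := [set _ | _ in _].
  have F_ub : ubound F 1.
    by move=> _ [a a1 <-]; rewrite psi_norm ler_pdivrMl// mulr1 E_le.
  apply/eqP; rewrite eq_le; apply/andP; split.
    apply: ge_sup F_ub; exists (complex.Re `|psi 0|), 0 => //=.
    by rewrite normr0 ler01.
  suff : m <= m * sup F by rewrite ler_pMr.
  apply: ge_sup E0 _ => _ [a a1 <-].
  have F_le (r : R) : F r -> r <= sup F by apply: (ub_le_sup (ex_intro _ _ F_ub)).
  rewrite -ler_pdivrMl// -psi_norm; apply: F_le.
  by exists a.
Qed.

End States.

(** * Representations are contractive *)

Lemma real_form_CauchySchwarz (R : realType) (V : lmodType R[i]) (B : V -> V -> R) :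
  (forall x y z, B (x + y) z = B x z + B y z) ->
  (forall (r : R) x y, B (r%:C *: x) y = r * B x y) ->
  (forall x y, B x y = B y x) -> (forall x, 0 <= B x x) ->
  forall x y, B x y ^+ 2 <= B x x * B y y.
Proof.
move=> BD BZ BC B0 x y.
have h (r : R) : 0 <= r ^+ 2 * B x x + 2 * r * B x y + B y y.
  have := B0 (r%:C *: x + y).
  rewrite BD BZ (BC x) (BC y) !BD !BZ (BC y x); lra.
have [xx0|xx0] := eqVneq (B x x) 0.
  have [->|xy0] := eqVneq (B x y) 0; first by rewrite expr0n mulr_ge0.
  (* When [B x x = 0] the quadratic is affine in [r], and this [r] gives it the value [-1]. *)
  have := h (- (B y y + 1) / (2 * B x y)); rewrite xx0 mulr0 add0r.
  have -> : 2 * (- (B y y + 1) / (2 * B x y)) * B x y = - (B y y + 1) by field.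
  lra.
have {}xx0 : 0 < B x x by rewrite lt_def xx0 B0.
have := h (- B x y / B x x).
have -> : (- B x y / B x x) ^+ 2 * B x x + 2 * (- B x y / B x x) * B x y + B y y =
    (B x x * B y y - B x y ^+ 2) / B x x by field; rewrite gt_eqF.
by rewrite pmulr_lge0 ?invr_gt0// subr_ge0.
Qed.

Section Hilbert.
Context {R : realType} {H : hilbertType R}.
Implicit Types (x y z : H) (S T : H -> H).

Definition re_inner x y : R := complex.Re (inner x y).

Lemma innerC x y : inner x y = Num.conj (inner y x).
Proof. by rewrite hermC expr0 mul1r. Qed.

Lemma re_innerC x y : re_inner x y = re_inner y x.
Proof. by rewrite /re_inner innerC; case: (inner y x). Qed.

Lemma re_innerDl x y z : re_inner (x + y) z = re_inner x z + re_inner y z.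
Proof. by rewrite /re_inner linearDl raddfD. Qed.

Lemma re_innerZl (r : R) x y : re_inner (r%:C *: x) y = r * re_inner x y.
Proof.
rewrite /re_inner linearZl_LR /=; case: (inner x y) => u v /=.
by rewrite mul0r subr0.
Qed.

Lemma re_innerNl x y : re_inner (- x) y = - re_inner x y.
Proof. by have := re_innerZl (-1) x y; rewrite rmorphN1 scaleN1r mulN1r. Qed.

Lemma re_innerBl x y z : re_inner (x - y) z = re_inner x z - re_inner y z.
Proof. by rewrite re_innerDl re_innerNl. Qed.

Lemma re_inner_nrm x : re_inner x x = nrm x ^+ 2.
Proof. by rewrite /re_inner inner_norm nrmE -rmorphXn. Qed.

Lemma re_inner_adjoint S T x y : adjoint S T -> re_inner (S x) y = re_inner x (T y).
Proof. by rewrite /re_inner => ->. Qed.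

Lemma positive_form_CauchySchwarz T : linear T -> adjoint T T ->
  (forall x, 0 <= re_inner (T x) x) ->
  forall x y, re_inner (T x) y ^+ 2 <= re_inner (T x) x * re_inner (T y) y.
Proof.
move=> Tlin Tadj T0.
apply: (real_form_CauchySchwarz (B := fun x y => re_inner (T x) y)) => //.
- by move=> x y z; have := Tlin 1 x y; rewrite !scale1r => ->; rewrite re_innerDl.
- move=> r x y; have T00 : T 0 = 0.
    by apply: (addrI (T 0)); rewrite -{1}[T 0]scale1r -Tlin scale1r !addr0.
  by have := Tlin r%:C x 0; rewrite !addr0 T00 addr0 => ->; rewrite re_innerZl.
- by move=> x y; rewrite (re_inner_adjoint _ _ Tadj) re_innerC.
Qed.

Lemma re_inner_le x y : re_inner x y <= nrm x * nrm y.
Proof.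
apply: sqr_le_nonneg; first by rewrite mulr_ge0 ?nrm_ge0.
rewrite exprMn -!re_inner_nrm.
apply: (@positive_form_CauchySchwarz id) => // z.
by rewrite re_inner_nrm sqr_ge0.
Qed.

(** For [0 <= T <= M] this is [T^2 <= M T], by Cauchy-Schwarz at [x] and [T x]: [|T x|^4 <= <T x, x>
    <T T x, T x> <= <T x, x> M |T x|^2]. If [T x = 0], the sign of [M] is read off the hypothesis at
    [x], unless [x = 0]. *)
Lemma nrm_sq_le_form T (M : R) : linear T -> adjoint T T ->
  (forall x, 0 <= re_inner (T x) x <= M * nrm x ^+ 2) ->
  forall x, nrm (T x) ^+ 2 <= M * re_inner (T x) x.
Proof.
move=> Tlin Tadj TM x.
have T0 z : 0 <= re_inner (T z) z by have /andP[] := TM z.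
have := positive_form_CauchySchwarz Tlin Tadj T0 x (T x).
have /andP[_] := TM (T x); have := T0 x; rewrite re_inner_nrm.
have /andP[] := TM x; have := sqr_ge0 (nrm (T x)).
have [->|n0] := eqVneq (nrm (T x) ^+ 2) 0.
  move=> _ h0 h1 _ _ _; have [x0|x0] := eqVneq (nrm x ^+ 2) 0.
    move: h0 h1; rewrite x0 mulr0 => h0 h1.
    have -> : re_inner (T x) x = 0 by lra.
    by rewrite mulr0.
  have {}x0 : 0 < nrm x ^+ 2 by rewrite lt_def x0 sqr_ge0.
  by rewrite mulr_ge0// -(pmulr_lge0 _ x0) (le_trans h0).
move=> n1 _ _ t0 h1 h2.
have {n1}n0 : 0 < nrm (T x) ^+ 2 by rewrite lt_def n0.
rewrite -(ler_pM2r n0) -expr2; apply: le_trans h2 _.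
by rewrite -mulrA mulrCA ler_wpM2l.
Qed.

Lemma nrm_le_form T (M : R) : 0 <= M -> linear T -> adjoint T T ->
  (forall x, 0 <= re_inner (T x) x <= M * nrm x ^+ 2) ->
  forall x, nrm (T x) <= M * nrm x.
Proof.
move=> M0 Tlin Tadj TM x; apply: sqr_le_nonneg; first by rewrite mulr_ge0 ?nrm_ge0.
apply: le_trans (nrm_sq_le_form Tlin Tadj TM x) _.
rewrite exprMn [M ^+ 2]expr2 -mulrA ler_wpM2l//.
by have /andP[] := TM x.
Qed.

End Hilbert.

Section Representation.
Context {R : realType} {A : cstarAlgType R} {H : hilbertType R}.
Variables (pi : A -> H -> H) (pi_rep : representation pi).
Implicit Types (a b : A) (x y : H).

Lemma rep_linear a : linear (pi a). Proof. by have [/(_ a)[]] := pi_rep. Qed.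
Lemma repD a b x : pi (a + b) x = pi a x + pi b x.
Proof. by have [_ /(_ x 1 a b)] := pi_rep; rewrite !scale1r. Qed.
Lemma rep0 x : pi 0 x = 0.
Proof. by apply: (addrI (pi 0 x)); rewrite -repD !addr0. Qed.
Lemma repZ k a x : pi (k *: a) x = k *: pi a x.
Proof. by have [_ /(_ x k a 0)] := pi_rep; rewrite rep0 !addr0. Qed.
Lemma repN a x : pi (- a) x = - pi a x.
Proof. by rewrite -scaleN1r repZ scaleN1r. Qed.
Lemma repB a b x : pi (a - b) x = pi a x - pi b x.
Proof. by rewrite repD repN. Qed.
Lemma repM a b x : pi (cmul a b) x = pi a (pi b x).
Proof. by have [_ _ ->] := pi_rep. Qed.
Lemma rep_adjoint a x y : re_inner (pi a x) y = re_inner x (pi (cstar a) y).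
Proof. by have [_ _ _ h] := pi_rep; exact: re_inner_adjoint (h a). Qed.
Lemma rep_star_mul a x : re_inner (pi (cmul (cstar a) a) x) x = nrm (pi a x) ^+ 2.
Proof. by rewrite repM rep_adjoint cstarK re_inner_nrm. Qed.

Lemma rep_cpos a x : cpos a -> 0 <= re_inner (pi a x) x.
Proof. by move=> [b ->]; rewrite rep_star_mul sqr_ge0. Qed.

(* [1 - a^*a = (1 - S)^2] with [S] an operator on [A], not an element of [A]: it
   acts on [y], whence the restriction to vectors of the form [pi y x]. *)
Lemma rep_contraction a (y : A) x :
  nrm a <= 1 -> nrm (pi a (pi y x)) <= nrm (pi y x).
Proof.
move=> a1; set b := cmul (cstar a) a.
have bE : cstar b = b by rewrite cstarM cstarK.
have b1 z : nrm (cmul b z) <= nrm z.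
  apply: le_trans (nrmM _ _) _; rewrite ler_piMl ?nrm_ge0// nrm_sq.
  by rewrite expr_le1// nrm_ge0.
have [S [SS _ SE _]] := contraction_sqrt (symmetric_lmul bE) b1.
apply: sqr_le_nonneg; first exact: nrm_ge0.
rewrite -repM -!rep_star_mul -subr_ge0 -re_innerBl -repB.
have -> : cmul (cstar y) y - cmul (cstar (cmul a y)) (cmul a y) =
    cmul (cstar (y - S y)) (y - S y).
  rewrite cstarB cmulBl SS.2 cstarM -cmulA -cmulBr.
  rewrite [cmul (cstar a) _]cmulA -cmulBr [S (_ - _)]linearB; congr (cmul _ _).
  have -> : cmul b y = S y + S y - S (S y) by rewrite SE addrK.
  by rewrite -addrA [in LHS]opprD addrA.
by rewrite rep_star_mul sqr_ge0.
Qed.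

(** A vector need not be of the form [pi y x]; but [|pi b x|^2 = <x, pi (cstar b) (pi b x)>], where
    the preceding bound applies to [cstar b]. *)
Lemma nrm_rep a x : nrm (pi a x) <= nrm a * nrm x.
Proof.
suff h b : nrm b <= 1 -> nrm (pi b x) <= nrm x.
  have [a0|a0] := eqVneq (nrm a) 0.
    by rewrite (nrm0_eq0 a0) rep0 !nrm0 mul0r.
  have {}a0 : 0 < nrm a by rewrite lt_def a0 nrm_ge0.
  have := h ((nrm a)^-1%:C *: a); rewrite repZ !nrmZr gtr0_norm ?invr_gt0//.
  by rewrite mulVf ?gt_eqF// => /(_ (lexx _)); rewrite ler_pdivrMl.
move=> b1; have [b0|b0] := eqVneq (nrm (pi b x)) 0; first by rewrite b0 nrm_ge0.
have {}b0 : 0 < nrm (pi b x) by rewrite lt_def b0 nrm_ge0.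
rewrite -(ler_pM2r b0) -expr2 -re_inner_nrm rep_adjoint.
apply: le_trans (re_inner_le _ _) _; rewrite ler_wpM2l ?nrm_ge0//.
by apply: rep_contraction; rewrite nrm_star.
Qed.

End Representation.

(** * The universal representation is isometric *)

Section Isometry.
Context {R : realType} {A : cstarAlgType R}.
Implicit Types (a b z : A).

Lemma positive_lmulD a b : positive_op (cmul a) -> positive_op (cmul b) ->
  positive_op (cmul (a + b)).
Proof.
by move=> aP bP; apply: positive_ext (positiveD aP bP) => x; rewrite cmulDl.
Qed.

Lemma positive_lmulZ (r : R) a : 0 <= r -> positive_op (cmul a) ->
  positive_op (cmul (r%:C *: a)).
Proof.
by move=> r0 aP; apply: positive_ext (positiveZ r0 aP) => x; rewrite cmulZl.
Qed.

Lemma positive_lmul0 : positive_op (cmul (0 : A)).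
Proof. by have := positive_lmul_star (0 : A); rewrite cmul0r. Qed.

(** With [k = z^2], [1/4 - (k - k^2) = (1 - 2k)^2 / 4], and [|1 - 2k| <= 1] by
    [contraction_sub_sq]. *)
Lemma positive_sq_sub_sq4 z : cstar z = z -> nrm z <= 1 ->
  positive_op (cmul (cmul z z - cmul (cmul z z) (cmul z z))).
Proof.
move=> zE z1; have zS := symmetric_lmul zE.
have z_le x : nrm (cmul z x) <= nrm x.
  by apply: le_trans (nrmM _ _) _; rewrite ler_piMl ?nrm_ge0.
have e1 := contraction_sub_sq zS z_le.
split; first by apply: symmetric_lmul; rewrite cstarB !cstarM zE.
exists (4^-1) => [|x]; first by rewrite invr_gt0.
pose k := cmul (cmul z z).
have kE y : cmul z (cmul z y) = k y by rewrite /k cmulA.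
have {}e1 y : nrm (y - (k y + k y)) <= nrm y by rewrite -!kE.
have -> : (4^-1)%:C *: x - cmul (cmul z z - cmul (cmul z z) (cmul z z)) x =
    (4^-1)%:C *: (x - (k x + k x) - (k (x - (k x + k x)) + k (x - (k x + k x)))).
  have kkE : cmul (cmul z z - cmul (cmul z z) (cmul z z)) x = k x - k (k x).
    by rewrite cmulBl -(cmulA (cmul z z)).
  have four (y : A) : (4^-1)%:C *: (y + y + (y + y)) = y.
    rewrite -!scale2C scalerA -rmorphM scalerA -rmorphM.
    by have -> : 4^-1 * 2 * 2 = 1 :> R; [lra | rewrite rmorph1 scale1r].
  rewrite kkE -[X in _ - X]four -scalerBr; congr (_ *: _).
  rewrite /k !cmulBr !cmulDr -/k.
  have D (p q : A) : p - q + (p - q) = p + p - (q + q) by rewrite opprD addrACA.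
  by rewrite !D -[in RHS]addrA -[in RHS]opprD [in RHS]addrA.
rewrite nrmZr ger0_norm ?invr_ge0// ler_wpM2l ?invr_ge0//.
exact: le_trans (e1 _) (e1 _).
Qed.

Fixpoint sq_iter n a : A :=
  if n is n'.+1 then cmul (sq_iter n' a) (sq_iter n' a) else a.

Lemma sq_iter_star n a : cstar a = a -> cstar (sq_iter n a) = sq_iter n a.
Proof. by move=> aE; elim: n => //= n IH; rewrite cstarM IH. Qed.

Lemma nrm_sq_iter n a : cstar a = a -> nrm a = 1 -> nrm (sq_iter n a) = 1.
Proof.
move=> aE a1; elim: n => //= n IH.
by rewrite -{1}(sq_iter_star n aE) nrm_sq IH expr1n.
Qed.

(** The shift by one matters: [a] need not be positive, nor [a - a^2]; from [a^2] on, each step is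
    [positive_sq_sub_sq4]. *)
Lemma sq_iter_nd a n m : cstar a = a -> nrm a = 1 -> (n <= m)%N ->
  positive_op (cmul (sq_iter n.+1 a - sq_iter m.+1 a)).
Proof.
move=> aE a1; elim: m => [|m IH].
  by rewrite leqn0 => /eqP ->; rewrite subrr; exact: positive_lmul0.
rewrite leq_eqVlt => /predU1P[->|]; first by rewrite subrr; exact: positive_lmul0.
rewrite ltnS => /IH nm.
have := positive_sq_sub_sq4 (sq_iter_star m aE).
rewrite nrm_sq_iter// => /(_ (lexx _)) /(positive_lmulD nm).
by rewrite addrA subrK.
Qed.

(* No bound on the norm of the vector representing a state is available; working
   with all the powers [a^(2^n)], which decrease, makes its value irrelevant. *)
Lemma exists_state_sq_iter a : cstar a = a -> nrm a = 1 ->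
  exists2 psi : A -> R[i], state psi &
    exists2 c : R, 0 < c & forall n, c <= complex.Re (psi (sq_iter n.+1 a)).
Proof.
move=> aE a1.
pose G := [set g : R * A | [/\ cstar g.2 = g.2, 0 <= g.1 &
  exists n, positive_op (cmul (g.2 - g.1%:C *: sq_iter n.+1 a))]].
have hP n : positive_op (cmul (sq_iter n.+1 a)).
  by rewrite /= -{1}(sq_iter_star n aE); exact: positive_lmul_star.
have GC : cone G.
  split.
  - split => //=; first exact: cstar0.
    by exists 0%N; rewrite rmorph0 scale0r subrr; exact: positive_lmul0.
  - move=> [s g] [t h] [/= gE s0 [n gn]] [/= hE t0 [m hm]]; split => /=.
    + by rewrite cstarD gE hE.
    + exact: addr_ge0.
    (* As the powers decrease, a lower bound by one of them is also a lower bound by every later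
       one. *)
    exists (maxn n m).
    have := positive_lmulD
      (positive_lmulD gn (positive_lmulZ s0 (sq_iter_nd aE a1 (leq_maxl n m))))
      (positive_lmulD hm (positive_lmulZ t0 (sq_iter_nd aE a1 (leq_maxr n m)))).
    rewrite !scalerBr !addrA !subrK rmorphD scalerDl opprD.
    by congr (positive_op (cmul _)); rewrite addrACA !addrA.
  - move=> r [s g] r0 [/= gE s0 [n gn]]; split => /=.
    + by rewrite cstarZr gE.
    + exact: mulr_ge0.
    exists n; rewrite rmorphM -scalerA -scalerBr; exact: positive_lmulZ.
have [||||psi psiS [c c0 Gpsi]] := exists_state GC.
- by move=> g [].
- move=> [t g] [/= gE t0 [n gn]].
  rewrite -[t]mulr1 -(nrm_sq_iter n.+1 aE a1) -{1}(ger0_norm t0) -nrmZr.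
  apply: nrm_lmul; first exact: nrm_ge0.
  apply: (nrm_le_add_positive (k := cmul (g - t%:C *: sq_iter n.+1 a))) => //.
  + exact: positive_lmulZ.
  + exact: nrm_ge0.
  by move=> x /=; rewrite -cmulDl addrC subrK nrmM.
- move=> b [d bE]; split => //=; first by rewrite bE cstarM cstarK.
  by exists 0%N; rewrite rmorph0 scale0r subr0 bE; exact: positive_lmul_star.
- exists (1, sq_iter 1 a) => //; split => //; first by rewrite /= cstarM aE.
  by exists 0%N; rewrite rmorph1 scale1r subrr; exact: positive_lmul0.
exists psi => //; exists c => // n; rewrite -[c]mulr1.
apply: (Gpsi (1, sq_iter n.+1 a)); split => //.
  exact: (sq_iter_star n.+1 aE).
by exists n; rewrite rmorph1 scale1r subrr; exact: positive_lmul0.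
Qed.

(** If [|pi a| <= M < |a|], then [h = a^* a/|a|^2] has norm [1] while [pi h] has norm at most
    [r < 1]. A state that is at least [c > 0] on all the iterated squares of [h] is then not a
    vector state, since its values would be at most [r^n |xi|^2]. *)
Lemma rep_isometry (H : hilbertType R) (pi : A -> H -> H) a (M : R) :
  universal_representation pi -> 0 <= M ->
  (forall x, nrm (pi a x) <= M * nrm x) -> nrm a <= M.
Proof.
move=> [pi_rep [xi [xiP _ _]]] M0 aM; rewrite leNgt; apply/negP => Ma.
have a0 : 0 < nrm a := le_lt_trans M0 Ma.
pose h := ((nrm a ^+ 2)^-1)%:C *: cmul (cstar a) a.
have hE : cstar h = h by rewrite cstarZr cstarM cstarK.
have h1 : nrm h = 1.
  rewrite nrmZr nrm_sq ger0_norm ?invr_ge0 ?sqr_ge0// mulVf//.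
  by rewrite expf_neq0// gt_eqF.
pose r := (M / nrm a) ^+ 2.
have r0 : 0 <= r by exact: sqr_ge0.
have q0 : 0 <= M / nrm a by rewrite divr_ge0// ltW.
have r1 : r < 1 by rewrite expr_lt1// ltr_pdivrMr// mul1r.
have asM x : nrm (pi (cstar a) x) <= M * nrm x.
  have [s0|s0] := eqVneq (nrm (pi (cstar a) x)) 0.
    by rewrite s0 mulr_ge0 ?nrm_ge0.
  have {}s0 : 0 < nrm (pi (cstar a) x) by rewrite lt_def s0 nrm_ge0.
  rewrite -(ler_pM2r s0) -expr2 -re_inner_nrm rep_adjoint// cstarK.
  apply: le_trans (re_inner_le _ _) _; rewrite [M * _]mulrC -mulrA.
  by rewrite ler_wpM2l ?nrm_ge0.
have hr x : nrm (pi h x) <= r * nrm x.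
  rewrite repZ// nrmZr ger0_norm ?invr_ge0 ?sqr_ge0// repM//.
  rewrite ler_pdivrMl ?exprn_gt0// /r expr_div_n mulrA mulrCA mulfV ?mulr1.
    apply: le_trans (asM _) _; rewrite expr2 -mulrA ler_wpM2l//.
  by rewrite expf_neq0// gt_eqF.
have iter_r n x : nrm (pi (sq_iter n h) x) <= r ^+ n.+1 * nrm x.
  suff : nrm (pi (sq_iter n h) x) <= r ^+ (2 ^ n) * nrm x.
    move=> le_n; apply: le_trans le_n _; rewrite ler_wpM2r ?nrm_ge0//.
    by apply: ler_wiXn2l => //; [exact: ltW | exact: ltn_expl].
  elim: n x => [|n IH] x /=; first by rewrite expr1.
  rewrite repM// expnS mul2n -addnn exprD -mulrA.
  by apply: le_trans (IH _) _; rewrite ler_wpM2l// exprn_ge0.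
have [psi psiS [c c0 psic]] := exists_state_sq_iter hE h1.
have [_ psiE] := xiP _ psiS.
have c_le n : c <= r ^+ n * nrm (xi psi) ^+ 2.
  apply: le_trans (psic n) _; rewrite psiE.
  apply: le_trans (re_inner_le _ _) _.
  rewrite expr2 mulrA ler_wpM2r ?nrm_ge0//.
  apply: le_trans (iter_r _ _) _; rewrite ler_wpM2r ?nrm_ge0//.
  by apply: ler_wiXn2l => //; [exact: ltW | exact: leqW].
have : (fun n => nrm (xi psi) ^+ 2 * r ^+ n) @ \oo --> (0 : R).
  by apply: cvg_geometric; rewrite ger0_norm.
move=> /cvgrPdist_lt/(_ _ c0)[N _ /(_ N (leqnn N))] /=.
rewrite sub0r normrN mulrC ger0_norm; last first.
  by rewrite mulr_ge0 ?sqr_ge0 ?exprn_ge0.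
by rewrite ltNge c_le.
Qed.

End Isometry.

(** * Open projections *)

Lemma closure_nrmP (R : realType) (V : completeNormedModType R[i])
    (B : set V) (a : V) :
  closure B a <-> forall e : R, 0 < e -> exists2 b, B b & nrm (a - b) <= e.
Proof.
split.
- move=> Ba e e0; have [|b [Bb ab]] := Ba (ball a e%:C).
    by apply: nbhsx_ballx; rewrite ltcR.
  by exists b => //; move: ab; rewrite -ball_normE /= nrmE ltcR => /ltW.
- move=> Ba C /nbhs_ballP[e /= e0 aeC].
  have e_real : e = (complex.Re e)%:C by rewrite RRe_real // ger0_real // ltW.
  have e'0 : 0 < complex.Re e by rewrite -ltcR -e_real.
  have [|b Bb ab] := Ba (complex.Re e / 2); first by rewrite divr_gt0.
  exists b; split => //; apply: aeC; rewrite -ball_normE /= nrmE e_real ltcR.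
  by apply: le_lt_trans ab _; lra.
Qed.

Section Projections.
Context {R : realType} {A : cstarAlgType R} {H : hilbertType R}.
Implicit Types (a b : A) (u v x y z : H) (p q S T : H -> H).

Lemma re_inner0l x : re_inner 0 x = 0.
Proof. by have := re_innerZl 0 0 x; rewrite scaler0 mul0r. Qed.

Lemma re_inner_inj u v : (forall y, re_inner u y = re_inner v y) -> u = v.
Proof.
move=> uv; apply/eqP; rewrite -subr_eq0; apply/eqP/nrm0_eq0/eqP.
by rewrite -sqrf_eq0 -re_inner_nrm re_innerBl uv subrr.
Qed.

Lemma re_inner_cvg (I : Type) (F : set_system I) (FF : Filter F) (f : I -> H) u y :
  f @ F --> u -> re_inner (f i) y @[i --> F] --> re_inner u y.
Proof.
move=> /cvg_nrmP fu; apply/cvgrPdist_le => e e0.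
have d0 : 0 < e / (nrm y + 1) by rewrite divr_gt0// ltr_wpDl// nrm_ge0.
apply: filterS (fu _ d0) => i fi.
have yM (z : H) : re_inner z y <= nrm z * (nrm y + 1).
  by apply: le_trans (re_inner_le _ _) _; rewrite ler_wpM2l ?nrm_ge0 ?lerDl.
have z_le (z : H) : nrm z <= e / (nrm y + 1) -> re_inner z y <= e.
  move=> ze; apply: le_trans (yM z) _.
  by rewrite -ler_pdivlMr// ltr_wpDl// nrm_ge0.
rewrite ler_norml -re_innerBl lerNl -re_innerNl opprB z_le//= z_le//.
by rewrite nrm_sub.
Qed.

Section LinearMap.
Variables (T : H -> H) (Tlin : linear T).
Lemma linB x y : T (x - y) = T x - T y.
Proof. by rewrite -[- y]scaleN1r addrC Tlin scaleN1r addrC. Qed.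
End LinearMap.

Section Projection.
Variables (q : H -> H).
Hypotheses (q_lin : linear q) (qq : q \o q = q) (q_adj : adjoint q q).

Lemma proj_idem x : q (q x) = q x. Proof. by rewrite -[RHS](congr1 (@^~ x) qq). Qed.

Lemma re_inner_proj x : re_inner (q x) x = nrm (q x) ^+ 2.
Proof. by rewrite -{1}proj_idem (re_inner_adjoint _ _ q_adj) re_inner_nrm. Qed.

Lemma nrm_sub_proj x : nrm (x - q x) ^+ 2 = nrm x ^+ 2 - re_inner (q x) x.
Proof.
rewrite -!re_inner_nrm !re_innerBl ![re_inner _ (x - _)]re_innerC !re_innerBl.
have -> : re_inner (q x) (q x) = re_inner (q x) x.
  by rewrite (re_inner_adjoint _ _ q_adj) proj_idem re_innerC.
by rewrite [re_inner x (q x)]re_innerC subrr subr0.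
Qed.

Lemma re_inner_proj_le x : re_inner (q x) x <= nrm x ^+ 2.
Proof. by rewrite -subr_ge0 -nrm_sub_proj sqr_ge0. Qed.

Lemma nrm_proj_le x : nrm (q x) <= nrm x.
Proof.
apply: sqr_le_nonneg; first exact: nrm_ge0.
by rewrite -re_inner_proj re_inner_proj_le.
Qed.

End Projection.

Section Increasing.
Variables (q r : H -> H).
Hypotheses (q_lin : linear q) (qq : q \o q = q) (q_adj : adjoint q q).
Hypotheses (r_lin : linear r) (rr : r \o r = r) (r_adj : adjoint r r).
Hypothesis qr : forall x, re_inner (q x) x <= re_inner (r x) x.

(** At [x - r x] the form of [q] is at most that of [r], which vanishes there. *)
Lemma proj_le_compl x : q (r x) = q x.
Proof.
apply/eqP; rewrite eq_sym -subr_eq0 -linB//; apply/eqP/nrm0_eq0/eqP.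
rewrite -sqrf_eq0 eq_le sqr_ge0 andbT -re_inner_proj//.
apply: le_trans (qr _) _.
by rewrite linB// proj_idem// subrr re_inner0l.
Qed.

Lemma proj_le_compr x : r (q x) = q x.
Proof.
apply/eqP; rewrite eq_sym -subr_eq0; apply/eqP/nrm0_eq0/eqP.
rewrite -sqrf_eq0 eq_le sqr_ge0 andbT nrm_sub_proj//.
have := qr (q x); rewrite proj_idem// re_inner_nrm; lra.
Qed.

End Increasing.

Lemma bidual_le_form (pi : A -> H -> H) p q : bidual_le pi p q ->
  forall x, re_inner (p x) x <= re_inner (q x) x.
Proof.
move=> [S [S' [_ _ SS' qpE]]] x; rewrite -subr_ge0 -re_innerBl.
have -> : q x - p x = S' (S x) by rewrite -[LHS]/((q \- p) x) qpE.
by rewrite re_innerC -(re_inner_adjoint _ _ SS') re_inner_nrm sqr_ge0.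
Qed.

Section Rep.
Variables (pi : A -> H -> H) (pi_rep : representation pi).

Lemma rep_symmetric a : cstar a = a -> adjoint (pi a) (pi a).
Proof. by move=> aE x y; have [_ _ _ /(_ a)] := pi_rep; rewrite aE; exact. Qed.

Lemma bidual_rep a : bidual pi (pi a).
Proof.
split; first by have [h _ _ _] := pi_rep; exact: h.
by apply: subset_closure; exists a.
Qed.

(** The operator [T] can be taken to be [pi a] itself; the corner is then handled by identities on
    vectors. *)
Lemma cornerP p a : (forall x, p (p x) = p x) ->
  corner pi p a <-> forall x, pi a x = p (pi a (p x)).
Proof.
move=> pp; split=> [[T _ aE] x|aE].
  by rewrite aE /= !pp.
by exists (pi a); [exact: bidual_rep | apply/funext].
Qed.

(** Two vectors are approximated at once, for use at [pi (cstar a) v] and [pi a v]. The bound by [q]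
    holds because the forms of the net increase to that of [q]. *)
Lemma open_projection_approx q u v (e : R) : open_projection pi q -> 0 < e ->
  exists a, [/\ cstar a = a,
    forall x, 0 <= re_inner (pi a x) x <= re_inner (q x) x,
    nrm (pi a u - q u) <= e & nrm (pi a v - q v) <= e].
Proof.
move=> [_ [I [le [t [[[i0] lexx' letr ledir] tpos tle [_ tq]]]]]] e0.
have FF : Filter (net_filter le).
  apply: filter_from_filter; first by exists i0.
  move=> i j _ _; have [k [ik jk]] := ledir i j; exists k => // l kl.
  by split; [exact: letr ik kl | exact: letr jk kl].
have cvg_t x : pi (t i) x @[i --> net_filter le] --> q x.
  by move/pointwise_cvgP : tq; exact.
have [i hi] : exists i, nrm (pi (t i) u - q u) <= e /\ nrm (pi (t i) v - q v) <= e.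
  have /cvg_nrmP/(_ _ e0) hu := cvg_t u; have /cvg_nrmP/(_ _ e0) hv := cvg_t v.
  by have [i _ /(_ i (lexx' i))] := filterI hu hv; exists i.
exists (t i); split; [exact: cpos_star | move=> x | by case: hi | by case: hi].
rewrite rep_cpos//=.
have h := re_inner_cvg (y := x) FF (cvg_t x).
apply/ler_addgt0Pr => d d0.
have /cvgrPdist_le/(_ _ d0)[j _ hj] := h.
have [k [ik jk]] := ledir i j.
have := hj k jk; rewrite /= ler_distlC => /andP[_ hk].
have := rep_cpos pi_rep x (tle i k ik); rewrite repB// re_innerBl.
by lra.
Qed.

End Rep.
End Projections.

(** * Density *)

Section Main.
Context {R : realType} {A : cstarAlgType R} {H : hilbertType R}.
Variables (pi : A -> H -> H) (p_ : nat -> H -> H) (p : H -> H).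
Hypotheses (pi_univ : universal_representation pi)
  (p_open : forall n, open_projection pi (p_ n))
  (p_incr : forall n, bidual_le pi (p_ n) (p_ n.+1))
  (p_lim : sot_cvg (p_ @ \oo) p).
Implicit Types (a b : A) (x y u v : H).

Let pi_rep : representation pi := pi_univ.1.
Let pn_lin n : linear (p_ n). Proof. by have [[[[]]]] := p_open n. Qed.
Let pn_idem n : p_ n \o p_ n = p_ n. Proof. by have [[]] := p_open n. Qed.
Let pn_adj n : adjoint (p_ n) (p_ n). Proof. by have [[]] := p_open n. Qed.

Let pn_le n m x : (n <= m)%N ->
  re_inner (p_ n x) x <= re_inner (p_ m x) x.
Proof.
elim: m => [|m IH]; first by rewrite leqn0 => /eqP ->.
rewrite leq_eqVlt => /predU1P[->//|]; rewrite ltnS => /IH h.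
exact: le_trans h (bidual_le_form (p_incr m) x).
Qed.

Let pn_cvg x : p_ n x @[n --> \oo] --> p x.
Proof. by have [_ /pointwise_cvgP] := p_lim; exact. Qed.

Let p_lin : linear p. Proof. by have [[]] := p_lim. Qed.

(** That [p] is a projection is derived from the strong limit, starting here with the limit of
    [p_n p_m = p_n] as [m] grows. *)
Let pn_p n x : p_ n (p x) = p_ n x.
Proof.
apply/eqP; rewrite -subr_eq0; apply/eqP/nrm0_eq0/eqP.
rewrite eq_le nrm_ge0 andbT; apply/ler_addgt0Pr => e e0; rewrite add0r.
have /cvg_nrmP/(_ _ e0)[N _ hN] := @pn_cvg x.
have := hN (maxn N n) (leq_maxl _ _) => /= h.
rewrite -(proj_le_compl (pn_lin n) (pn_idem n) (pn_adj n) (pn_lin (maxn N n))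
  (pn_idem _) (fun y => pn_le y (leq_maxr N n)) x) -linB//.
apply: le_trans (nrm_proj_le (pn_idem n) (pn_adj n) _) _.
by rewrite nrm_sub.
Qed.

Let p_pn n x : p (p_ n x) = p_ n x.
Proof.
have h1 := @pn_cvg (p_ n x).
have h2 : p_ m (p_ n x) @[m --> \oo] --> p_ n x.
  apply: cvg_near_cst; exists n => // m /= nm.
  exact: (proj_le_compr (pn_idem n) (pn_idem m) (pn_adj m)
    (fun y => pn_le y nm)).
exact: cvg_unique h1 h2.
Qed.

Let p_idem x : p (p x) = p x.
Proof.
have := @pn_cvg (p x); under eq_fun do rewrite pn_p.
by move=> h; apply: cvg_unique h (@pn_cvg x).
Qed.

Let p_sym x y : re_inner (p x) y = re_inner x (p y).
Proof.
have h1 : re_inner (p_ n x) y @[n --> \oo] --> re_inner (p x) y.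
  by apply: re_inner_cvg; exact: pn_cvg.
have h2 : re_inner (p_ n y) x @[n --> \oo] --> re_inner (p y) x.
  by apply: re_inner_cvg; exact: pn_cvg.
have e : (fun n => re_inner (p_ n x) y) = (fun n => re_inner (p_ n y) x).
  by apply/funext => n; rewrite (re_inner_adjoint _ _ (pn_adj n)) re_innerC.
rewrite [RHS]re_innerC; move: h1 h2; rewrite e => h1 h2.
exact: cvg_unique h1 h2.
Qed.

Let p_le x : nrm (p x) <= nrm x.
Proof.
apply: nrm_le_eps => e e0.
have /cvg_nrmP/(_ _ e0)[N _ /(_ N (leqnn N))/= h] := @pn_cvg x.
have := nrmB (p_ N x) (p_ N x - p x); rewrite subKr.
by have := nrm_proj_le (pn_idem N) (pn_adj N) x; lra.
Qed.

Lemma closure_corner_subset (a : A) :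
  closure (\bigcup_(k in setT) corner pi (p_ k)) a ->
  corner pi p a.
Proof.
move=> /closure_nrmP a_cl; apply/(cornerP pi_rep _ p_idem) => x.
apply/eqP; rewrite -subr_eq0; apply/eqP/nrm0_eq0/eqP.
rewrite eq_le nrm_ge0 andbT; apply/ler_addgt0Pr => e e0; rewrite add0r.
have d0 : 0 < e / (2 * (nrm x + 1)).
  by rewrite divr_gt0// mulr_gt0// ltr_wpDl// nrm_ge0.
have [b [k _ /(cornerP pi_rep _ (proj_idem (pn_idem k))) bE] ab] := a_cl _ d0.
have b_p : p (pi b (p x)) = pi b x by rewrite bE pn_p p_pn -bE.
have -> : pi a x - p (pi a (p x)) = pi (a - b) x - p (pi (a - b) (p x)).
  by rewrite !(repB pi_rep) (linB p_lin) b_p opprB addrA subrK.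
have y_le y : nrm y <= nrm x -> nrm (pi (a - b) y) <= e / 2.
  move=> yx; apply: le_trans (nrm_rep pi_rep _ _) _.
  apply: (@le_trans _ _ (e / (2 * (nrm x + 1)) * (nrm x + 1))).
    apply: ler_pM => //; rewrite ?nrm_ge0//.
    by apply: le_trans yx _; rewrite lerDl.
  rewrite le_eqVlt; apply/orP; left; apply/eqP; field.
  by rewrite gt_eqF// ltr_wpDl// nrm_ge0.
apply: le_trans (nrmB _ _) _.
have := y_le x (lexx _); have := y_le (p x) (p_le x).
have := p_le (pi (a - b) (p x)); lra.
Qed.

(** Positivity and the bound by [p_k] are imposed on forms under [pi] rather than through [cpos],
    which makes the set visibly convex. *)
Let X : set A := [set a | cstar a = a /\
  exists k, forall x, 0 <= re_inner (pi a x) x <= re_inner (p_ k x) x].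

Let X_le a : X a -> forall x, 0 <= re_inner (pi a x) x <= nrm x ^+ 2.
Proof.
move=> [_ [k ak]] x; have /andP[-> h]/= := ak x.
exact: le_trans h (re_inner_proj_le (pn_idem k) (pn_adj k) x).
Qed.

Let X0 : X 0.
Proof.
split; first exact: cstar0.
exists 0%N => x; rewrite (rep0 pi_rep) re_inner0l lexx/=.
by rewrite re_inner_proj ?sqr_ge0.
Qed.

Let X_convex a b (s t : R) : X a -> X b -> 0 <= s -> 0 <= t -> s + t = 1 ->
  X (s%:C *: a + t%:C *: b).
Proof.
move=> [aE [k ak]] [bE [l bl]] s0 t0 st1; split.
  by rewrite cstarD !cstarZr aE bE.
exists (maxn k l) => x; rewrite (repD pi_rep) !(repZ pi_rep) re_innerDl !re_innerZl.
have /andP[a0 ax] := ak x; have /andP[b0 bx] := bl x.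
have kx := pn_le x (leq_maxl k l); have lx := pn_le x (leq_maxr k l).
apply/andP; split; first by rewrite addr_ge0 ?mulr_ge0.
rewrite -[leRHS]mul1r -st1 mulrDl lerD// ler_wpM2l//.
  exact: le_trans ax kx.
exact: le_trans bx lx.
Qed.

Variable a : A.

(* [aa^* - axa^* + a^*a - a^*xa] bounds both [(1 - x)a^*] and [(1 - x)a]. *)
Let defect (x : A) : A :=
  cmul (a - cmul a x) (cstar a) + cmul (cstar a - cmul (cstar a) x) a.

Let defect_form (x : A) v : re_inner (pi (defect x) v) v =
  (nrm (pi (cstar a) v) ^+ 2 - re_inner (pi x (pi (cstar a) v)) (pi (cstar a) v)) +
  (nrm (pi a v) ^+ 2 - re_inner (pi x (pi a v)) (pi a v)).
Proof.
rewrite (repD pi_rep) re_innerDl !(repM pi_rep) !(repB pi_rep) !re_innerBl.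
rewrite !(repM pi_rep) (rep_adjoint pi_rep a (pi (cstar a) v)).
rewrite (rep_adjoint pi_rep a (pi x _)) (rep_adjoint pi_rep (cstar a) (pi a v)).
by rewrite (rep_adjoint pi_rep (cstar a) (pi x _)) cstarK !re_inner_nrm.
Qed.

Let defect_star (x : A) : X x -> cstar (defect x) = defect x.
Proof.
move=> [xE _]; rewrite /defect !cmulBl cstarD !cstarB !cstarM !cstarK xE.
by rewrite !cmulA.
Qed.

Let defect_ge0 (x : A) v : X x -> 0 <= re_inner (pi (defect x) v) v.
Proof.
move=> Xx; rewrite defect_form.
have /andP[_ h1] := X_le Xx (pi (cstar a) v).
have /andP[_ h2] := X_le Xx (pi a v); lra.
Qed.

Let defect_convex (x y : A) (s t : R) v : s + t = 1 ->
  re_inner (pi (defect (s%:C *: x + t%:C *: y)) v) v =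
  s * re_inner (pi (defect x) v) v + t * re_inner (pi (defect y) v) v.
Proof.
move=> st1; rewrite !defect_form !(repD pi_rep) !(repZ pi_rep).
rewrite !re_innerDl !re_innerZl.
have -> : t = 1 - s by lra.
lra.
Qed.

Hypothesis a_corner : corner pi p a.

Let aE x : pi a x = p (pi a (p x)).
Proof. by have /(cornerP pi_rep _ p_idem) := a_corner. Qed.

Let p_a x : p (pi a x) = pi a x.
Proof. by rewrite aE p_idem. Qed.

Let a_p x : pi a (p x) = pi a x.
Proof. by rewrite aE p_idem -aE. Qed.

Let p_as x : p (pi (cstar a) x) = pi (cstar a) x.
Proof.
apply: re_inner_inj => y.
by rewrite p_sym !(rep_adjoint pi_rep) cstarK a_p.
Qed.

Let defect_small v (e : R) : 0 < e ->
  exists2 x : A, X x & re_inner (pi (defect x) v) v <= e.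
Proof.
move=> e0; set u1 := pi (cstar a) v; set u2 := pi a v.
pose M := nrm u1 + nrm u2 + 1.
have M0 : 0 < M by rewrite ltr_wpDl// addr_ge0 ?nrm_ge0.
(* For each [u], two errors of [e/(2M)] bound [|u - x u|] by [e/M], and [(e/M) |u|] summed over both
   vectors is at most [e]. *)
have d0 : 0 < e / (2 * M) by rewrite divr_gt0// mulr_gt0.
have /cvg_nrmP/(_ _ d0) h1 := @pn_cvg u1.
have /cvg_nrmP/(_ _ d0) h2 := @pn_cvg u2.
have [N _ /(_ N (leqnn N))[/= {}h1 {}h2]] := filterI h1 h2.
have [x [xE xle x1 x2]] := open_projection_approx pi_rep u1 u2 (p_open N) d0.
exists x; first by split => //; exists N.
rewrite defect_form -/u1 -/u2.
have u_le u : p u = u -> nrm (pi x u - p_ N u) <= e / (2 * M) ->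
    nrm (p_ N u - p u) <= e / (2 * M) ->
    nrm u ^+ 2 - re_inner (pi x u) u <= e / M * nrm u.
  move=> pu hx hp; rewrite -re_inner_nrm -re_innerBl.
  apply: le_trans (re_inner_le _ _) _; rewrite ler_wpM2r ?nrm_ge0//.
  have := nrmD (pi x u - p_ N u) (p_ N u - p u).
  rewrite addrA subrK pu nrm_sub.
  have -> : e / M = e / (2 * M) + e / (2 * M) by field; rewrite gt_eqF.
  by move: hp; rewrite pu; lra.
have := u_le u1 (p_as _) x1 h1; have := u_le u2 (p_a _) x2 h2.
have : e / M * nrm u1 + e / M * nrm u2 <= e.
  rewrite -mulrDr mulrAC ler_pdivrMr// ler_wpM2l ?(ltW e0)//.
  by rewrite /M lerDl.
by lra.
Qed.

(** Were every norm at least [d], the pairs [(t, g)] with [g >= (t/d) defect x] for some [x] in [X]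
    would satisfy [t <= |g|]. The resulting state is at least [c d] on every [defect x], against
    [defect_small] at its vector with [e = c d/2]. *)
Let exists_defect_lt (d : R) : 0 < d -> exists2 x : A, X x & nrm (defect x) < d.
Proof.
move=> d0; apply: contrapT => hX.
have {}hX (x : A) : X x -> d <= nrm (defect x).
  by move=> Xx; rewrite leNgt; apply/negP => xd; apply: hX; exists x.
pose G := [set g : R * A | [/\ cstar g.2 = g.2, 0 <= g.1 &
  exists2 x : A, X x & forall v,
    g.1 / d * re_inner (pi (defect x) v) v <= re_inner (pi g.2 v) v]].
have GC : cone G.
  split.
  - split => //=; first exact: cstar0.
    by exists 0 => // v; rewrite !mul0r (rep0 pi_rep) re_inner0l.
  - move=> [s g] [t h] [/= gE s0 [x Xx gx]] [/= hE t0 [y Xy hy]]; split => /=.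
    + by rewrite cstarD gE hE.
    + exact: addr_ge0.
    have [st0|st0] := eqVneq (s + t) 0.
      exists x => // v; rewrite st0 !mul0r (repD pi_rep g h) re_innerDl.
      have [s00 t00] : s = 0 /\ t = 0 by split; lra.
      have := gx v; have := hy v; rewrite s00 t00 !mul0r; lra.
    have st1 : s / (s + t) + t / (s + t) = 1 by rewrite -mulrDl divff.
    have {}st0 : 0 < s + t by rewrite lt_def st0 addr_ge0.
    (* [defect] is affine, so [s defect x + t defect y] is [s + t] times its value at this
       barycentre. *)
    exists ((s / (s + t))%:C *: x + (t / (s + t))%:C *: y).
      by apply: X_convex => //; apply: divr_ge0 => //; exact: ltW.
    move=> v; rewrite defect_convex// (repD pi_rep g h) re_innerDl.
    apply: le_trans _ (lerD (gx v) (hy v)); rewrite le_eqVlt; apply/orP; left.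
    by apply/eqP; field; rewrite !gt_eqF.
  - move=> r [s g] r0 [/= gE s0 [x Xx gx]]; split => /=.
    + by rewrite cstarZr gE.
    + exact: mulr_ge0.
    exists x => // v; rewrite (repZ pi_rep) re_innerZl -!mulrA ler_wpM2l//.
    by rewrite mulrA gx.
have [||||psi psiS [c c0 Gpsi]] := exists_state GC.
- by move=> g [].
- move=> [t g] [/= gE t0 [x Xx gx]].
  have [->|tN0] := eqVneq t 0; first exact: nrm_ge0.
  have {}t0 : 0 < t by rewrite lt_def tN0.
  have td0 : 0 < d / t by exact: divr_gt0.
  rewrite -(ler_pM2l td0) divfK// .
  apply: le_trans (hX _ Xx) _; apply: (rep_isometry pi_univ).
    by rewrite mulr_ge0 ?nrm_ge0// ltW.
  apply: nrm_le_form.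
  + by rewrite mulr_ge0 ?nrm_ge0// ltW.
  + exact: rep_linear.
  + by apply: (rep_symmetric pi_rep); exact: defect_star.
  move=> v; rewrite defect_ge0//=.
  have -> : re_inner (pi (defect x) v) v =
      d / t * (t / d * re_inner (pi (defect x) v) v).
    by field; rewrite !gt_eqF.
  rewrite -[leRHS]mulrA ler_wpM2l ?(ltW td0)//; apply: le_trans (gx v) _.
  apply: le_trans (re_inner_le _ _) _; rewrite expr2 mulrA ler_wpM2r ?nrm_ge0//.
  exact: nrm_rep.
- move=> b bpos; split => //=; first exact: cpos_star.
  by exists 0 => // v; rewrite !mul0r; exact: rep_cpos.
- exists (d, defect 0) => //; split => //=; [exact: defect_star | exact: ltW|].
  by exists 0 => // v; rewrite divff ?gt_eqF// mul1r.
have [_ [xi [xiP _ _]]] := pi_univ.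
have [_ psiE] := xiP _ psiS.
have cd0 : 0 < c * d by exact: mulr_gt0.
have [x Xx xs] := defect_small (xi psi) (divr_gt0 cd0 (ltr0n _ 2)).
have /Gpsi : G (d, defect x).
  split => //=; [exact: defect_star | exact: ltW|].
  by exists x => // v; rewrite divff ?gt_eqF// mul1r.
rewrite /= psiE -/(re_inner _ _); move: xs cd0; lra.
Qed.

Lemma corner_subset_closure : closure (\bigcup_(k in setT) corner pi (p_ k)) a.
Proof.
apply/closure_nrmP => e e0.
have e20 : 0 < e / 2 by exact: divr_gt0.
(* The norm of [defect x] bounds the squares of the two errors, whence the square of [e/2]. *)
have [x Xx xd] := exists_defect_lt (exprn_gt0 2 e20).
have [xE [k xk]] := Xx.
have x_lin := rep_linear pi_rep x.
have x_adj := rep_symmetric pi_rep xE.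
have x1 : nrm x <= 1.
  apply: (rep_isometry pi_univ) => // v.
  by apply: nrm_le_form => // w; rewrite mul1r X_le.
have small (b : A) : (forall v,
    nrm (pi b v) ^+ 2 - re_inner (pi x (pi b v)) (pi b v)
      <= re_inner (pi (defect x) v) v) -> nrm (b - cmul x b) <= e / 2.
  move=> hb; apply: (rep_isometry pi_univ); first exact: ltW.
  move=> v; set w := pi b v.
  have -> : pi (b - cmul x b) v = w - pi x w by rewrite (repB pi_rep) (repM pi_rep).
  apply: sqr_le_nonneg; first by rewrite mulr_ge0 ?nrm_ge0// ltW.
  (* [0 <= 1 - x <= 1] gives [(1 - x)^2 <= 1 - x]. *)
  have := @nrm_sq_le_form _ _ (fun z => z - pi x z) 1.
  move=> /(_ _ _ _ w) h; apply: le_trans (h _ _ _) _.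
  - by move=> l y z; rewrite x_lin scalerBr opprD addrACA.
  - by move=> y z; rewrite linearBl linearBr /= x_adj.
  - move=> y; have /andP[h1 h2] := X_le Xx y.
    by rewrite re_innerBl re_inner_nrm mul1r; apply/andP; split; lra.
  rewrite mul1r re_innerBl re_inner_nrm; apply: le_trans (hb v) _.
  apply: le_trans (re_inner_le _ _) _; rewrite exprMn [nrm v ^+ 2]expr2 mulrA.
  rewrite ler_wpM2r ?nrm_ge0//; apply: le_trans (nrm_rep pi_rep _ _) _.
  by rewrite ler_wpM2r ?nrm_ge0// ltW.
have h1 : nrm (a - cmul x a) <= e / 2.
  apply: small => v; rewrite defect_form lerDr subr_ge0.
  by have /andP[] := X_le Xx (pi (cstar a) v).
have h2 : nrm (a - cmul a x) <= e / 2.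
  rewrite -nrm_star cstarB cstarM xE.
  apply: small => v; rewrite defect_form lerDl subr_ge0.
  by have /andP[] := X_le Xx (pi a v).
exists (cmul x (cmul a x)).
  exists k => //; apply/(cornerP pi_rep _ (proj_idem (pn_idem k))) => v.
  (* [0 <= x <= p_k] forces [x p_k = x]: at [y - p_k y] the form of [x] is at most that of [p_k],
     which is [0]. *)
  have x_pk y : pi x (p_ k y) = pi x y.
    apply/eqP; rewrite eq_sym -subr_eq0 -(linB x_lin); apply/eqP/nrm0_eq0/eqP.
    rewrite -sqrf_eq0 eq_le sqr_ge0 andbT.
    have := nrm_sq_le_form x_lin x_adj (M := 1).
    move=> /(_ _ (y - p_ k y)) h; apply: le_trans (h _) _.
      by move=> z; rewrite mul1r; exact: X_le.
    rewrite mul1r; have /andP[_ h'] := xk (y - p_ k y); apply: le_trans h' _.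
    by rewrite (linB (pn_lin k)) (proj_idem (pn_idem k)) subrr re_inner0l.
  have pk_x y : p_ k (pi x y) = pi x y.
    apply: re_inner_inj => z.
    by rewrite (re_inner_adjoint _ _ (pn_adj k)) !(re_inner_adjoint _ _ x_adj) x_pk.
  by rewrite !(repM pi_rep) x_pk pk_x.
have -> : a - cmul x (cmul a x) = (a - cmul x a) + cmul x (a - cmul a x).
  by rewrite cmulBr addrA subrK.
apply: le_trans (nrmD _ _) _.
have := nrmM x (a - cmul a x).
have := ler_wpM2r (nrm_ge0 (a - cmul a x)) x1; lra.
Qed.

End Main.

Theorem lemma2p1 (R : realType) (A : cstarAlgType R) (H : hilbertType R)
  (pi : A -> H -> H) (p_ : nat -> H -> H) (p : H -> H) :
  separable A ->
  universal_representation pi ->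
  (forall n : nat, open_projection pi (p_ n)) ->
  (forall n : nat, bidual_le pi (p_ n) (p_ n.+1)) ->
  sot_cvg (p_ @ \oo) p ->
  corner pi p = closure (\bigcup_(k in [set: nat]) corner pi (p_ k)).
Proof.
move=> _ pi_univ p_open p_incr p_lim; apply/seteqP; split=> a.
  exact: corner_subset_closure.
exact: closure_corner_subset.
Qed.
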